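(* Let $r\geq 1$, let $\phi:A\to K\{\tau\}$ be a Drinfeld module of rank $r$ with $A=\mathbb{F}_q[T]$, let $g_r\in K$ be the leading coefficient of $\phi_T$ (the coefficient of $\tau^r$), and let $\psi:A\to K\{\tau\}$ be the rank $1$ Drinfeld module determined by $\psi_T=\gamma(T)+(-1)^{r-1}g_r\tau$. Let $a\in A$ be monic of degree $\geq 1$, and let $W_a$ be the map defined in the context. Then $W_a$ restricts to a map $W_a:\prod_{i=1}^r\phi[a]\to\psi[a]$ with the following properties: (1) It is $A$-multilinear, i.e. $A$-linear in each component, where $b\in A$ acts on $\phi[a]$ by $\phi_b$ and on $\psi[a]$ by $\psi_b$. (2) It is alternating: if $\beta_1,\ldots,\beta_r\in\phi[a]$ and $\beta_l=\beta_h$ for some $l\neq h$, then $W_a(\beta_1,\ldots,\beta_r)=0$. (3) If $a\notin\ker(\gamma)$, then $W_a:\prod_{i=1}^r\phi[a]\to\psi[a]$ is surjective and nondegenerate, the latter meaning: for each $i\in\{1,\ldots,r\}$ and $\beta_i\in\phi[a]$, if $W_a(\beta_1,\ldots,\beta_r)=0$ for all $\beta_1,\ldots,\beta_{i-1},\beta_{i+1},\ldots,\beta_r\in\phi[a]$, then $\beta_i=0$. (4) It is Galois invariant: $\sigma W_a(\beta_1,\ldots,\beta_r)=W_a(\sigma\beta_1,\ldots,\sigma\beta_r)$ for all $\beta_1,\ldots,\beta_r\in\phi[a]$ and all $\sigma\in\mathrm{Gal}(\overline{K}/K)$.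
   Context: Let $q$ be a prime power, $A=\mathbb{F}_q[T]$, $K$ a field containing $\mathbb{F}_q$ and equipped with an $\mathbb{F}_q$-algebra homomorphism $\gamma:A\to K$. Let $\overline{K}$ be an algebraic closure of $K$, $\tau:\overline{K}\to\overline{K}$, $\alpha\mapsto\alpha^q$, and $K\{\tau\}$ the noncommutative ring of polynomials in $\tau$ with coefficients in $K$ and commutation rule $\tau\alpha=\alpha^q\tau$ for $\alpha \in K$. An element $\sum_i c_i\tau^i\in K\{\tau\}$ acts on $\overline{K}$ by $\beta\mapsto\sum_i c_i\beta^{q^i}$. A Drinfeld module of rank $r\geq 1$ is an $\mathbb{F}_q$-algebra homomorphism $\phi:A\to K\{\tau\}$, $a\mapsto\phi_a$, such that for nonzero $a$ one has $\phi_a=\gamma(a)+\sum_{i=1}^{r\deg(a)}g_i(a)\tau^i$ with $g_{r\deg(a)}(a)\neq 0$. For $a\in A$, $\phi[a]=\{\beta\in\overline{K}:\phi_a(\beta)=0\}$ (and similarly $\psi[a]$); it is an $A$-module via $b\cdot\beta=\phi_b(\beta)$. $\mathrm{Gal}(\overline{K}/K)$ denotes the group of field automorphisms of $\overline{K}$ fixing $K$ pointwise. Polynomials $f_a$: for a monic $a\in\overline{\mathbb{F}}_q[T]$ of degree $n\geq 1$, factored as $a=(T-\alpha_1)\cdots(T-\alpha_n)$ with $\alpha_i\in\overline{\mathbb{F}}_q$ not necessarily distinct, define $$f_a(T_1,\ldots,T_r)=\sum_{1=i_0\leq i_1\leq\cdots\leq i_r=n}\ \prod_{j=1}^r\ \prod_{\substack{1\leq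 i\leq n\\ i\notin[i_{j-1},i_j]}}(T_j-\alpha_i)\in\overline{\mathbb{F}}_q[T_1,\ldots,T_r],$$ the sum being over integer tuples $(i_0,\ldots,i_r)$. It does not depend on the ordering of the roots, and if $a\in A$ then $f_a\in\mathbb{F}_q[T_1,\ldots,T_r]$. Moore determinant: $M(x_1,\ldots,x_r)=\det\big(x_i^{q^{j-1}}\big)_{1\leq i,j\leq r}$. Map $W_a$: for monic $a\in A$ of degree $n\geq 1$, write $f_a=\sum_{\mathbf{i}=(i_1,\ldots,i_r),\,0\leq i_1,\ldots,i_r\leq n-1}a_{\mathbf{i}}T_1^{i_1}\cdots T_r^{i_r}$ with $a_{\mathbf{i}}\in\mathbb{F}_q$, and define $W_a:\overline{K}^r\to\overline{K}$ by $$W_a(\beta_1,\ldots,\beta_r)=\sum_{\mathbf{i}}a_{\mathbf{i}}\,M\big(\phi_{T^{i_1}}(\beta_1),\ldots,\phi_{T^{i_r}}(\beta_r)\big),\qquad \beta_1,\ldots,\beta_r\in\overline{K}.$$ *)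

(* Defs.v *)
From HB Require Import structures.
From mathcomp Require Import all_boot all_order all_algebra all_field.
From mathcomp Require abelian.
From mathcomp Require Import mpoly.

Set Implicit Arguments.
Unset Strict Implicit.
Unset Printing Implicit Defensive.

Import GRing.Theory.
Local Open Scope ring_scope.

(* Skew polynomials sum_i c_i tau^i over R, with tau * c = s c * tau: the      *)
(* additive group of {poly R} (p`_i is the coefficient of tau^i) with a        *)
(* twisted product.                                                            *)
Definition skew_poly (R : nzRingType) (s : {rmorphism R -> R}) : Type :=
  {poly R}.

Section SkewPolyRing.
Variables (R : nzRingType) (s : {rmorphism R -> R}).
Implicit Types p q r : {poly R}.

HB.instance Definition _ := GRing.Zmodule.copy (skew_poly s) {poly R}.

Definition skew_mul p q : {poly R} :=
  \poly_(k < size p + size q) \sum_(i < k.+1) p`_i * iter i s q`_(k - i).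

Fact iter_s0 i : iter i s 0 = 0.
Proof. by elim: i => //= i ->; rewrite rmorph0. Qed.
Fact iter_s1 i : iter i s 1 = 1.
Proof. by elim: i => //= i ->; rewrite rmorph1. Qed.
Fact iter_sD i : {morph iter i s : x y / x + y}.
Proof. by move=> x y; elim: i => //= i ->; rewrite rmorphD. Qed.
Fact iter_sM i : {morph iter i s : x y / x * y}.
Proof. by move=> x y; elim: i => //= i ->; rewrite rmorphM. Qed.
Fact iter_s_sum i n (E : 'I_n -> R) :
  iter i s (\sum_(j < n) E j) = \sum_(j < n) iter i s (E j).
Proof. exact: (big_morph _ (iter_sD i) (iter_s0 i)). Qed.

Lemma coef_skew_mul p q k :
  (skew_mul p q)`_k = \sum_(i < k.+1) p`_i * iter i s q`_(k - i).
Proof.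
rewrite coef_poly; case: ltnP => // le_pq_k.
rewrite big1 // => j _; have [le_p_j|lt_j_p] := leqP (size p) j.
  by rewrite nth_default ?mul0r.
rewrite [q`__]nth_default ?iter_s0 ?mulr0 // leq_subRL; last first.
  by rewrite -ltnS.
by apply: leq_trans le_pq_k; rewrite leq_add2r ltnW.
Qed.

Lemma coef_skew_mul_rev p q k :
  (skew_mul p q)`_k = \sum_(i < k.+1) p`_(k - i) * iter (k - i) s q`_i.
Proof.
rewrite coef_skew_mul (reindex_inj rev_ord_inj) /=.
by apply: eq_bigr => j _; rewrite (sub_ordK j).
Qed.

Fact skew_mulA : associative skew_mul.
Proof.
move=> p q r; apply/polyP=> i; rewrite coef_skew_mul coef_skew_mul_rev.
pose coef3 j k :=
  p`_j * (iter j s q`_(i - j - k) * iter (i - k) s r`_k).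
transitivity (\sum_(j < i.+1) \sum_(k < i.+1 | (k <= i - j)%N) coef3 j k).
  apply: eq_bigr => /= j _.
  rewrite coef_skew_mul_rev iter_s_sum big_distrr /=.
  rewrite (big_ord_narrow_leq (leq_subr _ _)); apply: eq_bigr => k _ /=.
  rewrite iter_sM -iterD /coef3; congr (_ * (_ * iter _ _ _)).
  rewrite addnBA; last by rewrite -ltnS ltn_ord.
  by rewrite subnKC // -ltnS ltn_ord.
rewrite (exchange_big_dep predT) //=; apply: eq_bigr => k _.
transitivity (\sum_(j < i.+1 | (j <= i - k)%N) coef3 j k).
  apply: eq_bigl => j; rewrite -ltnS -(ltnS j) -!subSn ?leq_ord //.
  by rewrite -subn_gt0 -(subn_gt0 j) -!subnDA addnC.
rewrite (big_ord_narrow_leq (leq_subr _ _)) coef_skew_mul big_distrl /=.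
by apply: eq_bigr => j _; rewrite /coef3 -!subnDA addnC mulrA.
Qed.

Fact skew_mul1p : left_id 1%:P skew_mul.
Proof.
move=> p; apply/polyP => i; rewrite coef_skew_mul big_ord_recl subn0.
by rewrite big1 => [|j _]; rewrite coefC ?mul1r ?mul0r ?addr0.
Qed.

Fact skew_mulp1 : right_id 1%:P skew_mul.
Proof.
move=> p; apply/polyP => i; rewrite coef_skew_mul_rev big_ord_recl subn0.
rewrite big1 => [|j _]; rewrite coefC ?iter_s1 ?mulr1 ?addr0 //=.
by rewrite iter_s0 mulr0.
Qed.

Fact skew_mulDl : left_distributive skew_mul +%R.
Proof.
move=> p q r; apply/polyP=> i; rewrite coefD !coef_skew_mul -big_split.
by apply: eq_bigr => j _; rewrite coefD mulrDl.
Qed.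

Fact skew_mulDr : right_distributive skew_mul +%R.
Proof.
move=> p q r; apply/polyP=> i; rewrite coefD !coef_skew_mul -big_split.
by apply: eq_bigr => j _; rewrite coefD iter_sD mulrDr.
Qed.

HB.instance Definition _ := GRing.Zmodule_isNzRing.Build (skew_poly s)
  skew_mulA skew_mul1p skew_mulp1 skew_mulDl skew_mulDr (poly1_neq0 R).

Definition skew_coef (f : skew_poly s) (i : nat) : R := (f : {poly R})`_i.
Definition skewC (c : R) : skew_poly s := c%:P.
Definition tau : skew_poly s := 'X.

Lemma skew_tauC (c : R) : tau * skewC c = skewC (s c) * tau.
Proof.
apply/polyP => -[|k].
  rewrite !coef_skew_mul !big_ord_recl !big_ord0 !subn0.
  by rewrite !coefX !coefC /= mul0r mulr0.
rewrite !coef_skew_mul !big_ord_recl !big1 => [|j _|j _]; first last.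
- by rewrite coefX mul0r.
- by rewrite coefC mul0r.
rewrite !coefX !subn0 !coefC lift0 /= subSS subn0 !mul0r mul1r !add0r !addr0.
by case: k => [|k] /=; rewrite ?mulr1 ?rmorph0 ?mulr0.
Qed.

End SkewPolyRing.

(* Additivity of x |-> x^q needs K to contain F, whence the (computationally   *)
(* unused) embedding argument.                                                 *)
Definition frobq (F : finFieldType) (K : fieldType) (iota : {rmorphism F -> K})
  (x : K) : K := x ^+ #|F|.

Section FrobeniusMorphism.
Variables (F : finFieldType) (K : fieldType) (iota : {rmorphism F -> K}).

Lemma pnat_card_finField : [pchar K].-nat #|F|.
Proof.
have [p _ pcharF] := finPcharP F.
rewrite (eq_pnat _ (fmorph_pchar iota)) (eq_pnat _ (pcharf_eq pcharF)).
by rewrite -cardsT; case/and3P: (abelian.fin_ring_pchar_abelem pcharF).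
Qed.

Fact frobq_zmod : zmod_morphism (frobq iota).
Proof.
move=> x y; apply/eqP; rewrite eq_sym subr_eq; apply/eqP.
by rewrite /frobq -(exprDn_pchar _ _ pnat_card_finField) subrK.
Qed.

Fact frobq_monoid : monoid_morphism (frobq iota).
Proof. by split=> [|x y]; rewrite /frobq ?expr1n ?exprMn. Qed.

HB.instance Definition _ :=
  GRing.isZmodMorphism.Build K K (frobq iota) frobq_zmod.
HB.instance Definition _ :=
  GRing.isMonoidMorphism.Build K K (frobq iota) frobq_monoid.

End FrobeniusMorphism.

(* K{tau}, with tau * c = c ^+ q * tau. *)
Notation twisted_poly iota := (skew_poly (frobq iota)).

Definition twisted_act (F : finFieldType) (K : fieldType)
    (iota : {rmorphism F -> K}) (L : fieldType) (emb : {rmorphism K -> L})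
    (f : twisted_poly iota) (x : L) : L :=
  \sum_(i < size (f : {poly K})) emb (skew_coef f i) * x ^+ (#|F| ^ i).

(* deg b is (size b).-1; for b a nonzero constant the last three fields say    *)
(* phi_b = gamma(b).                                                           *)
Record drinfeld_module (F : finFieldType) (K : fieldType)
    (iota : {rmorphism F -> K}) (gamma : {rmorphism {poly F} -> K}) (r : nat) :=
  DrinfeldModule {
    drinfeld_hom :> {rmorphism {poly F} -> twisted_poly iota};
    drinfeldC : forall c : F, drinfeld_hom c%:P = skewC _ (iota c);
    drinfeld_coef0 : forall b : {poly F}, b != 0 ->
      skew_coef (drinfeld_hom b) 0 = gamma b;
    drinfeld_lead : forall b : {poly F}, b != 0 ->
      skew_coef (drinfeld_hom b) (r * (size b).-1) != 0;
    drinfeld_gt : forall (b : {poly F}) i, b != 0 -> (r * (size b).-1 < i)%N ->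
      skew_coef (drinfeld_hom b) i = 0
  }.

Definition torsion (F : finFieldType) (K : fieldType)
    (iota : {rmorphism F -> K}) (gamma : {rmorphism {poly F} -> K}) (r : nat)
    (phi : drinfeld_module iota gamma r) (L : fieldType)
    (emb : {rmorphism K -> L}) (a : {poly F}) : {pred L} :=
  [pred x | twisted_act emb (phi a) x == 0].

(* alpha lists the n roots; indices are shifted to start at 0, so the sum is   *)
(* over 0 = t_0 <= t_1 <= ... <= t_r = n - 1, and the j-th variable (from 0)   *)
(* avoids the roots with index in [t_j, t_(j+1)].                              *)
Definition fpoly_roots (r : nat) (L : fieldType) (alpha : seq L) :
    {mpoly L[r]} :=
  \sum_(t : {ffun 'I_r.+1 -> 'I_(size alpha)} |
        [&& t ord0 == 0 :> nat, t ord_max == (size alpha).-1 :> nat &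
          [forall j : 'I_r, t (widen_ord (leqnSn r) j) <= t (lift ord0 j)]%N])
    \prod_(j < r)
      \prod_(i < size alpha |
             ~~ (t (widen_ord (leqnSn r) j) <= i <= t (lift ord0 j))%N)
        ('X_j - (alpha`_i)%:MP).

(* f_a for monic a over an algebraically closed field, from some enumeration   *)
(* of the roots of a with multiplicity.                                        *)
Definition fpoly (r : nat) (L : closedFieldType) (a : {poly L}) : {mpoly L[r]} :=
  fpoly_roots r (sval (closed_field_poly_normal a)).

Definition moore_det (q r : nat) (L : fieldType) (x : 'I_r -> L) : L :=
  \det (\matrix_(i < r, j < r) x i ^+ (q ^ j)).

(* The algebraic closure of F is realised inside the algebraic closure L of K, *)
(* so that the coefficients of f_a, which lie in F, are directly elements of L.*)
Definition Wmap (F : finFieldType) (K : fieldType)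
    (iota : {rmorphism F -> K}) (gamma : {rmorphism {poly F} -> K}) (r : nat)
    (phi : drinfeld_module iota gamma r) (L : closedFieldType)
    (emb : {rmorphism K -> L}) (a : {poly F}) (beta : {ffun 'I_r -> L}) : L :=
  \sum_(m : {ffun 'I_r -> 'I_(size a).-1})
    (fpoly r (map_poly (emb \o iota) a))@_[multinom (m j : nat) | j < r] *
    moore_det #|F| (fun j : 'I_r => twisted_act emb (phi 'X^(m j)) (beta j)).

Definition fupd (r : nat) (L : Type) (beta : {ffun 'I_r -> L}) (i : 'I_r)
    (x : L) : {ffun 'I_r -> L} :=
  [ffun j => if j == i then x else beta j].

(* Main.v *)
Require Import Defs.
From mathcomp Require Import all_boot all_order all_algebra all_field.
From mathcomp Require Import perm mpoly.
Set Implicit Arguments.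
Unset Strict Implicit.
Unset Printing Implicit Defensive.
Import GRing.Theory.
Local Open Scope ring_scope.

(**
  Let n = deg a, let lam be the functional on F[T]/(a) reading off the
  coefficient of T^(n-1), and let e_0, ..., e_(n-1) be the basis dual to
  1, T, ..., T^(n-1) under (b, c) |-> lam (b c) (the Horner quotients of a).
  The sum defining f_a is Leibniz' rule for divided differences at the roots
  of a; read through powers of a bidiagonal matrix it becomes
    f_a = sum_k lam (T^(k_1 + ... + k_r)) e_(k_1)(T_1) ... e_(k_r)(T_r),
  so W_a (beta) = sum_k lam (T^(k_1 + ... + k_r)) M (phi_(e_(k_j)) (beta_j)).
  By duality, summing over one index k_i shows that on phi[a] the operator
  phi_T may be moved freely between slots.  Eliminating beta^(q^r) with
  phi_T gives psi_T (M (x)) = sum_i phi_T (x_i) cof_i (x), whence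
  psi_T (W_a) = W_a (.., phi_T (beta_i), ..).
  Nondegeneracy: as a polynomial in its last slot, W_a with s <= r slots has
  degree at most q^(r(n-1)+s-1) < q^(rn) = #phi[a], and its top coefficient is
  a nonzero multiple of the same expression with s - 1 slots; with one slot
  W_a is the identity.  Surjectivity: by nondegeneracy, for each irreducible
  p dividing a some value of W_a is not killed by psi_(a/p); gluing along
  idempotents of F[T]/(a) gives one value working for all p, and it generates
  psi[a] by counting.
*)

(** * Tuples with a distinguished slot, and matrix products as sums over walks *)

Section InsertFfun.
Variable I : Type.

(** The slots other than [i] are numbered by ['I_m] through [lift i], as in the expansion of a
    determinant along a row. *)
Definition finsert m (i : 'I_m.+1) (x : I) (t : {ffun 'I_m -> I}) :
    {ffun 'I_m.+1 -> I} :=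
  [ffun j => oapp t x (unlift i j)].

Lemma finsert_at m (i : 'I_m.+1) x t : finsert i x t i = x.
Proof. by rewrite ffunE unlift_none. Qed.

Lemma finsert_lift m (i : 'I_m.+1) x t (j : 'I_m) : finsert i x t (lift i j) = t j.
Proof. by rewrite ffunE liftK. Qed.

Lemma finsertK m (i : 'I_m.+1) (k : {ffun 'I_m.+1 -> I}) :
  finsert i (k i) [ffun j : 'I_m => k (lift i j)] = k.
Proof.
apply/ffunP=> j; rewrite ffunE; case: unliftP => [j'|] -> /=; last by [].
by rewrite ffunE.
Qed.

End InsertFfun.

Lemma big_finsert (I : finType) (V : nmodType) m (i : 'I_m.+1)
    (G : {ffun 'I_m.+1 -> I} -> V) :
  \sum_k G k = \sum_x \sum_(t : {ffun 'I_m -> I}) G (finsert i x t).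
Proof.
rewrite pair_big /= (reindex (fun p : I * {ffun 'I_m -> I} => finsert i p.1 p.2)) //.
exists (fun k : {ffun 'I_m.+1 -> I} => (k i, [ffun j : 'I_m => k (lift i j)]))
  => [[x t] _ | k _] /=.
  by rewrite finsert_at; congr (_, _); apply/ffunP=> j; rewrite ffunE finsert_lift.
exact: finsertK.
Qed.

Lemma sum_finsert (n m : nat) (i : 'I_m.+1) (x : 'I_n) (t : {ffun 'I_m -> 'I_n}) :
  (\sum_j finsert i x t j = x + \sum_j t j)%N.
Proof.
rewrite (bigD1_ord i) //= finsert_at; congr (_ + _)%N.
by apply: eq_bigr => j _; rewrite finsert_lift.
Qed.

(** A tuple (i_0, ..., i_r) in the definition of f_a is a walk with [r] steps; this turns a sum over
    such walks into an entry of a matrix product. *)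
Lemma mulmx_path_sum (R : comPzRingType) (n r : nat) (A : 'I_r -> 'M[R]_n.+1)
    (s u : 'I_n.+1) :
  \sum_(t : {ffun 'I_r.+1 -> 'I_n.+1} | (t ord0 == s) && (t ord_max == u))
    \prod_(j < r) A j (t (widen_ord (leqnSn r) j)) (t (lift ord0 j))
  = (\prod_(j < r) A j) s u.
Proof.
elim: r A s => [|r IHr] A s.
  rewrite big_ord0 big_mkcond (big_finsert ord0) /=.
  rewrite (bigD1 s) //= [X in _ + X]big1 ?addr0 => [|x xs].
    rewrite (bigD1 [ffun=> s]) //= [X in _ + X]big1 ?addr0; last first.
      by move=> t /eqP[]; apply/ffunP=> -[].
    rewrite (ord1 ord_max) finsert_at eqxx big_ord0 mxE /=.
    by case: (s == u).
  by apply: big1 => t _; rewrite finsert_at (negPf xs).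
rewrite big_ord_recl /= mxE big_mkcond (big_finsert ord0) /=.
rewrite (bigD1 s) //= [X in _ + X]big1 ?addr0 => [|x xs]; last first.
  by apply: big1 => t _; rewrite finsert_at (negPf xs).
under [RHS]eq_bigr => x _.
  rewrite -IHr big_mkcond mulr_sumr /=.
  over.
rewrite exchange_big /=; apply: eq_bigr => t _.
have -> : ord_max = lift ord0 ord_max :> 'I_r.+2 by apply: val_inj.
rewrite finsert_at finsert_lift eqxx /= (bigD1 (t ord0)) //= eqxx /=.
rewrite [X in _ = _ + X]big1 ?addr0 => [|x xt]; last by rewrite eq_sym (negPf xt) mulr0.
case: eqP => _; last by rewrite mulr0.
rewrite big_ord_recl; congr (A _ _ _ * _).
- by rewrite -[RHS](finsert_at ord0 s t); congr (finsert _ _ _ _); apply: val_inj.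
- by rewrite finsert_lift.
apply: eq_bigr => j _; rewrite finsert_lift; congr (A _ _ _).
by rewrite -(finsert_lift ord0 s t); congr (finsert _ _ _ _); apply: val_inj.
Qed.

(** * Horner quotients and the basis dual to the powers of T *)

Section HornerBasis.
Variable (R : nzRingType) (a : {poly R}) (n : nat).
Hypotheses (a_monic : a \is monic) (size_a : size a = n.+1).

Lemma drop_polySX k (p : {poly R}) : drop_poly k p = (p`_k)%:P + drop_poly k.+1 p * 'X.
Proof.
apply/polyP=> -[|i]; rewrite coefD coefC coefMX !coef_drop_poly /= ?addr0 //.
by rewrite add0r addSnnS.
Qed.

Lemma drop_poly_lead : drop_poly n a = 1.
Proof.
apply/polyP=> -[|i]; rewrite coef_drop_poly coef1 /=.
  by move/monicP: a_monic; rewrite /lead_coef size_a.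
by rewrite nth_default // size_a addSn ltnS leq_addl.
Qed.

(** Since [drop_poly k a] and [drop_poly k.+1 a * 'X] differ by a constant, the sum telescopes from
    [drop_poly 0 a = a] to [drop_poly n a = 1]. When [u] obeys the linear recurrence with
    characteristic polynomial [a], the constant on the right vanishes, and shifting [u] amounts to
    multiplication by ['X] modulo [a]. *)
Lemma horner_basis_telescope (u : nat -> R) :
  \sum_(k < n) u k *: (drop_poly k.+1 a * 'X) - \sum_(k < n) u k.+1 *: drop_poly k.+1 a
  = u 0%N *: a - (\sum_(k < n.+1) u k * a`_k)%:P.
Proof.
have E (k : nat) : drop_poly k.+1 a * 'X = drop_poly k a - (a`_k)%:P.
  by rewrite (drop_polySX k a) addrC addKr.
under eq_bigr do rewrite E scalerBr.
rewrite sumrB big_ord_recr /= rmorphD rmorph_sum /=.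
have -> : a`_n = 1 by move/monicP: a_monic; rewrite /lead_coef size_a.
rewrite mulr1; under [X in _ - X - _]eq_bigr do rewrite -mul_polyC -polyCM.
rewrite -addrA [- _ - _]addrC addrA opprD addrA [RHS]addrAC; congr (_ - _).
rewrite -sumrB.
have T := telescope_sumr (fun k => u k *: drop_poly k a) (leq0n n).
rewrite /= drop_poly0l drop_poly_lead in T.
apply: oppr_inj; rewrite -alg_polyC opprB -T big_mkord -sumrN.
by apply: eq_bigr => i _; rewrite opprB.
Qed.

End HornerBasis.

(* The index is deg a - 1. *)
Definition top_coef_mod (F : fieldType) (a c : {poly F}) : F := (c %% a)`_(size a).-2.

Section TopCoefMod.
Variables (F : fieldType) (a : {poly F}) (n : nat).
Hypotheses (a_monic : a \is monic) (size_a : size a = n.+2).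
Local Notation lam := (top_coef_mod a).

Lemma top_coef_modD c d : lam (c + d) = lam c + lam d.
Proof. by rewrite /top_coef_mod modpD coefD. Qed.

Lemma top_coef_modZ k c : lam (k *: c) = k * lam c.
Proof. by rewrite /top_coef_mod modpZl coefZ. Qed.

Lemma top_coef_modXn x : (x < n.+1)%N -> lam 'X^x = (x == n)%:R.
Proof.
move=> lt_x; rewrite /top_coef_mod modp_small ?size_polyXn ?size_a //.
by rewrite coefXn eq_sym.
Qed.

(** The sum is [lam (c * a)]; so [lam (c * 'X^k)] obeys, in [k], the recurrence attached to [a]. *)
Lemma top_coef_mod_rec c : \sum_(k < n.+2) lam (c * 'X^k) * a`_k = 0.
Proof.
transitivity (lam (c * a)); last by rewrite /top_coef_mod modp_mull coef0.
rewrite -[X in lam (c * X)]coefK poly_def size_a mulr_sumr.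
rewrite (big_morph lam top_coef_modD (id1 := 0)); last by rewrite /top_coef_mod mod0p coef0.
by apply: eq_bigr => k _; rewrite -scalerAr top_coef_modZ mulrC.
Qed.

(** Telescoping with [u x = lam (c * 'X^x)] shows that the left side, as a function of [c], commutes
    with multiplication by ['X] modulo [a]; on constants it is the identity. *)
Lemma top_coef_mod_dual c :
  \sum_(x < n.+1) lam (c * 'X^x) *: drop_poly x.+1 a = c %% a.
Proof.
have a0 : a != 0 by rewrite monic_neq0.
set R := fun c => \sum_(x < n.+1) lam (c * 'X^x) *: drop_poly x.+1 a.
have sizeR d : (size (R d) < size a)%N.
  rewrite size_a ltnS; apply: leq_trans (size_sum _ _ _) _.
  apply/bigmax_leqP=> x _; apply: leq_trans (size_scale_leq _ _) _.
  by rewrite size_drop_poly size_a subSS leq_subr.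
(* [R c] is already reduced modulo [a], so a congruence is enough. *)
rewrite -/(R c) -[LHS](modp_small (sizeR c)).
elim/poly_ind: c => [|c k IHc].
  rewrite /R big1 ?mod0p // => x _.
  by rewrite mul0r /top_coef_mod mod0p coef0 scale0r.
have -> : R (c * 'X + k%:P) = R c * 'X - lam c *: a + k%:P.
  have := horner_basis_telescope a_monic size_a (fun x => lam (c * 'X^x)).
  rewrite top_coef_mod_rec polyC0 subr0 expr0 mulr1.
  under eq_bigr do rewrite scalerAl.
  rewrite -mulr_suml -/(R c) => <-; rewrite opprB [_ + (_ - _)]addrC subrK.
  rewrite /R; under eq_bigr do
    rewrite mulrDl top_coef_modD scalerDl mul_polyC top_coef_modZ -mulrA -exprS.
  rewrite big_split /=; congr (_ + _).
  (* For the constant [k] only [x = n] contributes, and there the quotient is 1. *)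
  rewrite big_ord_recr /= big1 => [|x _]; last first.
    by rewrite top_coef_modXn ?ltn_eqF ?mulr0 ?scale0r //= ltnW // ltnS.
  by rewrite add0r top_coef_modXn // eqxx mulr1 (drop_poly_lead a_monic size_a) alg_polyC.
rewrite !modpD [R c * _]mulrC -[('X * R c) %% a]modp_mul IHc modp_mul mulrC; congr (_ + _).
by rewrite modpN modpZl modpp scaler0 oppr0 addr0.
Qed.

End TopCoefMod.

(** * Divided differences at the roots through a bidiagonal matrix *)

Section FpolyRoots.
Variables (L : fieldType) (n : nat) (alpha : seq L).
Hypothesis size_alpha : size alpha = n.+1.
Local Notation a := (\prod_(z <- alpha) ('X - z%:P)).

(* Powers of this matrix list divided differences: the (s, t) entry of J ^+ k is
   the divided difference of x^k at alpha_s, ..., alpha_t. *)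
Definition bidiag : 'M[L]_n.+1 :=
  \matrix_(s, t) (alpha`_s *+ (s == t) + (s.+1 == t :> nat)%:R).
Local Notation J := bidiag.

Let size_prodXsub : size a = n.+2.
Proof. by rewrite size_prod_XsubC size_alpha. Qed.

Let monic_prodXsub : a \is monic. Proof. exact: monic_prod_XsubC. Qed.

Lemma bidiag_char_poly : char_poly J = a.
Proof.
rewrite /char_poly -det_tr det_trig.
  rewrite [RHS](big_nth 0) big_mkord size_alpha; apply: eq_bigr => i _.
  by rewrite !mxE eqxx /= (gtn_eqF (ltnSn i)) addr0.
apply/is_trig_mxP=> i j ij; rewrite !mxE.
rewrite [j == i]eq_sym (negPf (_ : i != j)); last first.
  by apply: contraTneq ij => ->; rewrite ltnn.
by rewrite (gtn_eqF (leqW ij)) !mulr0n addr0 polyC0 subr0.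
Qed.

Lemma mul_bidiag (A : 'M[L]_n.+1) (s t : 'I_n.+1) :
  (J *m A) s t = alpha`_s * A s t
    + (if (s < n)%N then A (inord s.+1) t else 0).
Proof.
rewrite mxE; under eq_bigr do rewrite mxE mulrDl.
rewrite big_split /=; congr (_ + _).
  rewrite (bigD1 s) //= eqxx big1 ?addr0 // => i /negPf si.
  by rewrite eq_sym si mul0r.
case: ltnP => sn.
  rewrite (bigD1 (inord s.+1)) //= inordK // eqxx mul1r big1 ?addr0 // => i.
  rewrite -val_eqE /= inordK // => /negPf si.
  by rewrite eq_sym si mul0r.
apply: big1 => i _; rewrite gtn_eqF ?mul0r //.
exact: leq_trans (ltn_ord i) _.
Qed.

Lemma bidiagXS k (s t : 'I_n.+1) :
  (J ^+ k.+1) s t = alpha`_s * (J ^+ k) s t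
    + (if (s < n)%N then (J ^+ k) (inord s.+1) t else 0).
Proof. by rewrite exprS -mul_bidiag. Qed.

(** By Cayley-Hamilton the entries of [J ^+ k *m A] obey the same recurrence in [k] as in
    [top_coef_mod_rec]. *)
Lemma bidiagXn_rec (A : 'M[L]_n.+1) s t :
  \sum_(k < n.+2) (J ^+ k *m A) s t * a`_k = 0.
Proof.
have := congr1 (fun B => (B *m A) s t) (Cayley_Hamilton J).
rewrite bidiag_char_poly mul0mx [in X in _ = X]mxE => E; rewrite -[RHS]E {E}.
rewrite /horner_mx /= -[X in horner_morph _ X]coefK poly_def rmorph_sum /=.
rewrite mulmx_suml summxE size_prodXsub; apply: eq_bigr => k _.
rewrite -mul_polyC rmorphM rmorphXn /= horner_morphC horner_morphX.
by rewrite -mulmxE mul_scalar_mx -scalemxAl [RHS]mxE mulrC.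
Qed.

(** Each factor [J] raises the index by at most one, and a raise has weight 1. *)
Lemma bidiagX_upper k (s t : 'I_n.+1) :
  (s + k <= t)%N -> (J ^+ k) s t = (s + k == t)%N%:R.
Proof.
elim: k s => [|k IHk] s.
  by rewrite addn0 expr0 mxE -val_eqE.
rewrite addnS => lt_t; have lt_s : (s < n)%N.
  rewrite -ltnS; apply: leq_ltn_trans (ltn_ord t).
  by apply: leq_trans lt_t; rewrite ltnS leq_addr.
rewrite bidiagXS lt_s IHk ?(ltnW lt_t) // ltn_eqF // mulr0 add0r.
by rewrite IHk inordK ?addSn.
Qed.

(** Both sides obey the recurrence of [a] and start with 0, ..., 0, 1. *)
Lemma bidiag_top_coef k : (J ^+ k) ord0 ord_max = top_coef_mod a 'X^k.
Proof.
have [m] := ubnP k; elim: m k => // m IHm k; rewrite ltnS => le_k_m.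
have [lt_k|le_k] := ltnP k n.+1.
  by rewrite bidiagX_upper // (top_coef_modXn size_prodXsub).
have an : a`_n.+1 = 1 by move/monicP: monic_prodXsub; rewrite /lead_coef size_prodXsub.
have := bidiagXn_rec (J ^+ (k - n.+1)) ord0 ord_max.
have := top_coef_mod_rec size_prodXsub 'X^(k - n.+1).
rewrite ![\sum_(_ < _.+2) _]big_ord_recr /= an !mulr1 -exprD subnK // => /eqP.
rewrite addrC addr_eq0 => /eqP -> /eqP.
rewrite -[_ *m _]/(_ * _) -exprD subnKC // addrC addr_eq0 => /eqP ->.
congr (- _); apply: eq_bigr => x _; rewrite -[_ *m _]/(_ * _) -!exprD addnC IHm //.
rewrite (leq_trans _ le_k_m) // -{2}(subnK le_k) ltn_add2l //.
Qed.

Definition root_prod_outside (s t : nat) : {poly L} :=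
  \prod_(i < n.+1 | ~~ (s <= i <= t)%N) ('X - (alpha`_i)%:P).

(** The sum of x^k e_k(X) is (a(X) - a(x)) / (X - x). Its divided difference in x at alpha_s, ...,
    alpha_t does not see a(x), which vanishes there with multiplicity, and equals a(X) divided by
    the factors X - alpha_i with s <= i <= t. *)
Lemma root_prod_outsideE (s t : 'I_n.+1) :
  (if (s <= t)%N then root_prod_outside s t else 0)
  = \sum_(k < n.+1) (J ^+ k) s t *: drop_poly k.+1 a.
Proof.
have prodE : a = \prod_(i < n.+1) ('X - (alpha`_i)%:P).
  by rewrite [LHS](big_nth 0) big_mkord size_alpha.
pose N (s t : 'I_n.+1) := \sum_(k < n.+1) (J ^+ k) s t *: drop_poly k.+1 a.
(* Both sides will satisfy this recursion, which computes row [u] from row [u.+1]; the last row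
   [u = n] has no successor. *)
have recN (u v : 'I_n.+1) : N u v * ('X - (alpha`_u)%:P)
    = (if (u < n)%N then N (inord u.+1) v else 0) + (if u == v then a else 0).
  have := horner_basis_telescope monic_prodXsub size_prodXsub (fun k => (J ^+ k) u v).
  have -> : \sum_(k < n.+2) (J ^+ k) u v * a`_k = 0.
    rewrite -[RHS](bidiagXn_rec 1%:M u v).
    by apply: eq_bigr => k _; rewrite mulmx1.
  rewrite expr0 mxE polyC0 subr0.
  have -> : (u == v)%:R *: a = if u == v then a else 0.
    by case: eqP => _; rewrite ?scale1r ?scale0r.
  move=> <-.
  have -> : \sum_(k < n.+1) (J ^+ k) u v *: (drop_poly k.+1 a * 'X) = N u v * 'X.
    by rewrite mulr_suml; apply: eq_bigr => k _; rewrite scalerAl.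
  have -> : \sum_(k < n.+1) (J ^+ k.+1) u v *: drop_poly k.+1 a
      = N u v * (alpha`_u)%:P + (if (u < n)%N then N (inord u.+1) v else 0).
    rewrite (_ : (if _ then _ else _) = \sum_(k < n.+1)
        (if (u < n)%N then (J ^+ k) (inord u.+1) v else 0) *: drop_poly k.+1 a).
      rewrite mulr_suml -big_split; apply: eq_bigr => k _ /=.
      by rewrite bidiagXS scalerDl [_ * _%:P]mulrC mul_polyC scalerA.
    by case: ifP => // _; rewrite big1 // => k _; rewrite scale0r.
  by rewrite mulrBr opprD [X in _ = _ + X]addrA [RHS]addrC subrK.
pose Q (s t : 'I_n.+1) := if (s <= t)%N then root_prod_outside s t else 0.
have recQ (u v : 'I_n.+1) : Q u v * ('X - (alpha`_u)%:P)
    = (if (u < n)%N then Q (inord u.+1) v else 0) + (if u == v then a else 0).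
  rewrite /Q; case: (ltngtP u v) => [lt_uv|lt_vu|/val_inj eq_uv].
  - have un : (u < n)%N by rewrite -ltnS (leq_trans _ (ltn_ord v)).
    rewrite un inordK // lt_uv -val_eqE ltn_eqF // addr0 /root_prod_outside.
    rewrite [RHS](bigD1 u) /=; last by rewrite ltnn.
    rewrite mulrC; congr (_ * _); apply: eq_bigl => i.
    rewrite -val_eqE /=; case: (ltngtP i u) => [iu|iu|->] /=; rewrite ?andbT ?andbF //.
    by rewrite (ltnW lt_uv).
  - rewrite mul0r -val_eqE gtn_eqF // addr0; case: ifP => // un.
    by rewrite inordK // leqNgt ltnS ltnW.
  rewrite eq_uv eqxx; have -> : (if (v < n)%N then if ((inord v.+1 : 'I_n.+1) <= v)%N then
      root_prod_outside (inord v.+1 : 'I_n.+1) v else 0 else 0) = 0.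
    by case: ifP => // vn; rewrite inordK // ltnn.
  rewrite add0r prodE (bigD1 v) //= mulrC; congr (_ * _); apply: eq_bigl => i.
  by rewrite -val_eqE /=; case: (ltngtP i v).
(* Downward induction on the row, cancelling the factor ['X - alpha_u]. *)
suff NQ m (u : 'I_n.+1) : (n - u < m)%N -> Q u t = N u t by exact: (NQ n.+1 s (leq_subr _ _)).
elim: m u => // m IHm u le_m.
apply: (mulIf (negbT (polyXsubC_eq0 alpha`_u))); rewrite recQ recN.
case: ifP => // un; rewrite IHm // inordK // -ltnS (leq_trans _ le_m) // ltnS.
by rewrite ltn_sub2l.
Qed.

End FpolyRoots.

(** * The expansion of f_a in the dual basis *)

Section PolyInOneVariable.
Variables (L : fieldType) (r : nat).

Definition poly_at_var (j : 'I_r) (p : {poly L}) : {mpoly L[r]} :=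
  (map_poly (@mpolyC r L) p).['X_j].

Lemma poly_at_var_sum (j : 'I_r) n (c : 'I_n -> L) (p : 'I_n -> {poly L}) :
  poly_at_var j (\sum_i c i *: p i) = \sum_i c i *: poly_at_var j (p i).
Proof.
rewrite /poly_at_var rmorph_sum horner_sum /=; apply: eq_bigr => i _.
by rewrite map_polyZ hornerZ mul_mpolyC.
Qed.

Lemma poly_at_var_prodXsub (j : 'I_r) n (P : pred 'I_n) (c : 'I_n -> L) :
  poly_at_var j (\prod_(i < n | P i) ('X - (c i)%:P)) = \prod_(i < n | P i) ('X_j - (c i)%:MP).
Proof.
rewrite /poly_at_var rmorph_prod horner_prod /=; apply: eq_bigr => i _.
by rewrite rmorphB /= map_polyX map_polyC hornerXsubC.
Qed.

Lemma mcoeff_prod_poly_at_var n (p : 'I_r -> {poly L}) (m : {ffun 'I_r -> 'I_n}) :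
  (forall j, size (p j) <= n)%N ->
  (\prod_j poly_at_var j (p j))@_[multinom (m j : nat) | j < r] = \prod_j (p j)`_(m j).
Proof.
move=> size_p.
have pE j : poly_at_var j (p j) = \sum_(i < n) (p j)`_i *: 'X_j ^+ i.
  rewrite /poly_at_var (@horner_coef_wide _ n); last first.
    by apply: leq_trans (size_p j); rewrite size_poly.
  by apply: eq_bigr => i _; rewrite coef_map mul_mpolyC.
under eq_bigr do rewrite pE.
rewrite bigA_distr_bigA /= raddf_sum /= (bigD1 m) //= [X in _ + X]big1 ?addr0 => [|f fm].
  rewrite scaler_prod mcoeffZ.
  rewrite (_ : \prod_j _ = 'X_[[multinom (m j : nat) | j < r]]).
    by rewrite mcoeffX eqxx mulr1.
  by rewrite mpolyXE_id; apply: eq_bigr => j _; rewrite mnmE.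
rewrite scaler_prod mcoeffZ.
rewrite (_ : \prod_j _ = 'X_[[multinom (f j : nat) | j < r]]).
  rewrite mcoeffX; case: eqP; rewrite ?mulr0 // => /mnmP eq_fm.
  case/eqP: fm; apply/ffunP=> j; apply: val_inj.
  by have := eq_fm j; rewrite !mnmE.
by rewrite mpolyXE_id; apply: eq_bigr => j _; rewrite mnmE.
Qed.

End PolyInOneVariable.

(** The length of [alpha] occurs in the type of the index [t], so it has to be exchanged for [N] in
    the whole expression at once. *)
Lemma fpoly_roots_cast (L : fieldType) (r N : nat) (alpha : seq L) : size alpha = N ->
  fpoly_roots r alpha =
  \sum_(t : {ffun 'I_r.+1 -> 'I_N} |
        [&& t ord0 == 0 :> nat, t ord_max == N.-1 :> nat &
          [forall j : 'I_r, t (widen_ord (leqnSn r) j) <= t (lift ord0 j)]%N])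
    \prod_(j < r)
      \prod_(i < N | ~~ (t (widen_ord (leqnSn r) j) <= i <= t (lift ord0 j))%N)
        ('X_j - (alpha`_i)%:MP).
Proof. by move=> <-. Qed.

(* Leibniz' rule for the divided differences of a product, in generating form. *)
Lemma fpoly_rootsE (L : fieldType) (r n : nat) (alpha : seq L) :
  let a := \prod_(z <- alpha) ('X - z%:P) in
  size alpha = n.+1 ->
  fpoly_roots r alpha = \sum_(k : {ffun 'I_r -> 'I_n.+1})
    top_coef_mod a 'X^(\sum_j k j) *: \prod_j poly_at_var j (drop_poly (k j).+1 a).
Proof.
move=> a size_alpha; rewrite (fpoly_roots_cast _ size_alpha).
pose J := bidiag n alpha.
(* The order condition on [t] moves into the summand: [J] is upper triangular, so a descent in [t]
   gives a factor 0. *)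
transitivity (\sum_(t : {ffun 'I_r.+1 -> 'I_n.+1} | (t ord0 == ord0) && (t ord_max == ord_max))
    \prod_(j < r) \sum_(k < n.+1)
      (J ^+ k) (t (widen_ord (leqnSn r) j)) (t (lift ord0 j))
        *: poly_at_var j (drop_poly k.+1 a)).
  rewrite [LHS]big_mkcond [RHS]big_mkcond; apply: eq_bigr => t _ /=.
  rewrite andbA (_ : (t ord0 == 0%N :> nat) && (t ord_max == n :> nat)
    = (t ord0 == ord0) && (t ord_max == ord_max)) //.
  set ends := (t ord0 == ord0) && _; case: ends => //=.
  case: ifP => [/forallP mono | /negbT].
    apply: eq_bigr => j _; rewrite -poly_at_var_sum -(root_prod_outsideE size_alpha).
    by rewrite mono poly_at_var_prodXsub.
  rewrite negb_forall => /existsP[j /negPf nle].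
  rewrite (bigD1 j) //= -poly_at_var_sum -(root_prod_outsideE size_alpha) nle.
  by rewrite /poly_at_var map_poly0 horner0 mul0r.
under eq_bigr do rewrite bigA_distr_bigA /=.
rewrite exchange_big /=; apply: eq_bigr => k _.
rewrite -(bidiag_top_coef size_alpha) -/J.
(* For fixed exponents [k] the sum over [t] is a walk sum, and powers of the single matrix [J]
   multiply by adding exponents. *)
have -> : J ^+ (\sum_j k j) = \prod_j J ^+ k j.
  by rewrite (big_morph _ (exprD J) (expr0 J)).
rewrite -mulmx_path_sum scaler_suml; apply: eq_bigr => t _.
by rewrite scaler_prod.
Qed.

(** The expansion involves [a] but not its roots, so the coefficients come from [F] and do not
    depend on the enumeration chosen by [closed_field_poly_normal]. *)
Lemma mcoeff_fpoly (F : fieldType) (L : closedFieldType) (f : {rmorphism F -> L})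
    (r n : nat) (a : {poly F}) (m : {ffun 'I_r -> 'I_n.+1}) :
  a \is monic -> size a = n.+2 ->
  (fpoly r (map_poly f a))@_[multinom (m j : nat) | j < r]
  = f (\sum_(k : {ffun 'I_r -> 'I_n.+1})
        top_coef_mod a 'X^(\sum_j k j) * \prod_j (drop_poly (k j).+1 a)`_(m j)).
Proof.
move=> a_monic size_a; rewrite /fpoly.
case: closed_field_poly_normal => alpha /= aE.
rewrite lead_coef_map (monicP a_monic) rmorph1 scale1r in aE.
have size_alpha : size alpha = n.+1.
  by apply: succn_inj; rewrite -(size_prod_XsubC alpha id) -aE size_map_poly size_a.
rewrite (fpoly_rootsE _ size_alpha) -aE raddf_sum rmorph_sum /=; apply: eq_bigr => k _.
rewrite mcoeffZ mcoeff_prod_poly_at_var => [|j]; last first.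
  by rewrite size_drop_poly size_map_poly size_a subSS leq_subr.
rewrite rmorphM rmorph_prod; congr (_ * _); last first.
  by apply: eq_bigr => j _; rewrite !coef_drop_poly coef_map.
by rewrite /top_coef_mod -(map_polyXn f) -map_modp size_map_poly coef_map.
Qed.

(** * The action of K{tau} and its additive polynomials *)

Section TwistedAct.
Variables (F : finFieldType) (K : fieldType) (iota : {rmorphism F -> K}).
Variables (L : fieldType) (emb : {rmorphism K -> L}).
Local Notation q := #|F|.
Local Notation act := (@twisted_act F K iota L emb).
Local Notation inF c := (emb (iota c)).
Implicit Types f g : twisted_poly iota.

Lemma card_gt1 : (1 < q)%N. Proof. exact: finNzRing_gt1. Qed.

Lemma exprq_D j (x y : L) : (x + y) ^+ (q ^ j) = x ^+ (q ^ j) + y ^+ (q ^ j).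
Proof.
apply: exprDn_pchar; rewrite pnatX.
by rewrite (pnat_card_finField (emb \o iota : {rmorphism F -> L})).
Qed.

Lemma exprq_0 j : (0 : L) ^+ (q ^ j) = 0.
Proof. by rewrite expr0n expn_eq0 -leqn0 leqNgt (ltnW card_gt1). Qed.

Lemma exprq_sum j (I : Type) (s : seq I) (P : pred I) (G : I -> L) :
  (\sum_(i <- s | P i) G i) ^+ (q ^ j) = \sum_(i <- s | P i) G i ^+ (q ^ j).
Proof. exact: (big_morph _ (exprq_D j) (exprq_0 j)). Qed.

Lemma exprq_F j (c : F) : inF c ^+ (q ^ j) = inF c.
Proof.
rewrite -!rmorphXn; congr (emb (iota _)).
by elim: j => [|j IHj]; rewrite ?expr1 // expnS exprM expf_card.
Qed.

Lemma iter_frobq i (c : K) : iter i (frobq iota) c = c ^+ (q ^ i).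
Proof. by elim: i => [|i IHi] //=; rewrite IHi /frobq -exprM expnSr. Qed.

Lemma act_wide N f x : (size (f : {poly K}) <= N)%N ->
  act f x = \sum_(i < N) emb (skew_coef f i) * x ^+ (q ^ i).
Proof.
move=> le_N; rewrite /twisted_act.
rewrite (big_ord_widen N (fun i => emb (skew_coef f i) * x ^+ (q ^ i))) //.
rewrite big_mkcond; apply: eq_bigr => i _; case: ltnP => // le_i.
by rewrite /skew_coef nth_default // rmorph0 mul0r.
Qed.

Lemma act_addl f g x : act (f + g) x = act f x + act g x.
Proof.
pose N := maxn (size (f : {poly K})) (size (g : {poly K})).
rewrite !(@act_wide N) ?leq_maxl ?leq_maxr ?size_polyD // -big_split /=.
by apply: eq_bigr => i _; rewrite /skew_coef coefD rmorphD mulrDl.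
Qed.

Lemma act_skewC c x : act (skewC _ c) x = emb c * x.
Proof.
rewrite (@act_wide 1) ?size_polyC_leq1 // big_ord1.
by rewrite /skew_coef coefC expn0 expr1.
Qed.

Lemma act_tau x : act (tau _) x = x ^+ q.
Proof.
rewrite (@act_wide 2) ?size_polyX // big_ord_recl big_ord1 /skew_coef !coefX /=.
by rewrite rmorph0 mul0r add0r rmorph1 mul1r expn1.
Qed.

Lemma act_mul f g x : act (f * g) x = act f (act g x).
Proof.
set m := size (f : {poly K}); set n := size (g : {poly K}).
rewrite (@act_wide (m + n)) ?size_poly //.
pose G i j := emb ((f : {poly K})`_i) * (emb ((g : {poly K})`_j) * x ^+ (q ^ j)) ^+ (q ^ i).
transitivity (\sum_(0 <= k < m + n) \sum_(0 <= i < m + n | (i <= k)%N) G i (k - i)%N).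
  rewrite big_mkord; apply: eq_bigr => k _.
  rewrite /skew_coef (coef_skew_mul (frobq iota) f g k) rmorph_sum mulr_suml.
  rewrite big_mkord (big_ord_widen (m + n) (fun i =>
    emb ((f : {poly K})`_i * iter i (frobq iota) ((g : {poly K})`_(k - i)))
      * x ^+ (q ^ k))) //.
  apply: eq_bigr => i le_i; rewrite rmorphM iter_frobq rmorphXn /G exprMn -mulrA.
  by rewrite -exprM -expnD subnK // -ltnS.
rewrite (exchange_big_dep_nat predT) //=.
rewrite (@act_wide (m + n) f) ?leq_addr // big_mkord; apply: eq_bigr => i _.
have [le_mi|lt_im] := leqP m i.
  rewrite /skew_coef nth_default // rmorph0 mul0r big1 // => k _.
  by rewrite /G nth_default // rmorph0 mul0r.
rewrite (@act_wide (m + n - i) g); last by rewrite leq_subRL ?leq_add2r ltnW.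
rewrite exprq_sum mulr_sumr.
rewrite -(big_mkord predT (fun j => _ * (emb (skew_coef g j) * x ^+ (q ^ j)) ^+ (q ^ i))).
rewrite (big_cat_nat _ (n := i)) //=; last by rewrite (leq_trans (ltnW lt_im)) ?leq_addr.
rewrite big_nat_cond big1 ?add0r; last by move=> k /andP[/andP[_ /ltn_geF ->]].
rewrite -[X in \sum_(X <= _ < _ | _) _]add0n big_addn big_nat_cond [RHS]big_nat_cond.
apply: eq_big => [k|k _]; first by rewrite leq_addl.
by rewrite addnK.
Qed.

Lemma act_addr f x y : act f (x + y) = act f x + act f y.
Proof.
by rewrite /twisted_act -big_split; apply: eq_bigr => i _; rewrite exprq_D mulrDr.
Qed.

Lemma act_0r f : act f 0 = 0.
Proof. by rewrite /twisted_act big1 // => i _; rewrite exprq_0 mulr0. Qed.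

Lemma act_F f c x : act f (inF c * x) = inF c * act f x.
Proof.
rewrite /twisted_act mulr_sumr; apply: eq_bigr => i _.
by rewrite exprMn exprq_F mulrCA.
Qed.

Lemma act_sumr f (I : Type) (s : seq I) (P : pred I) (G : I -> L) :
  act f (\sum_(i <- s | P i) G i) = \sum_(i <- s | P i) act f (G i).
Proof. exact: (big_morph _ (act_addr f) (act_0r f)). Qed.

(** The action as evaluation of an ordinary polynomial, so that zeros can be counted by degree. *)
Definition act_poly f : {poly L} :=
  \sum_(i < size (f : {poly K})) emb (skew_coef f i) *: 'X^(q ^ i).

Lemma act_polyE f x : (act_poly f).[x] = act f x.
Proof.
by rewrite horner_sum; apply: eq_bigr => i _; rewrite hornerZ hornerXn.
Qed.

Lemma coef_act_poly f d : (act_poly f)`_(q ^ d) = emb (skew_coef f d).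
Proof.
rewrite coef_sum; under eq_bigr => i _.
  rewrite coefZ coefXn eqn_exp2l ?card_gt1 // [d == _]eq_sym.
  over.
have [lt_d|le_d] := ltnP d (size (f : {poly K})).
  rewrite (bigD1 (Ordinal lt_d)) //= eqxx mulr1 big1 ?addr0 // => i.
  by rewrite -val_eqE => /negPf /= ->; rewrite mulr0.
rewrite /skew_coef [X in emb X]nth_default // rmorph0 big1 // => i _.
by rewrite ltn_eqF ?mulr0 // (leq_trans (ltn_ord i)).
Qed.

Lemma size_act_poly f d : (forall i, (d < i)%N -> skew_coef f i = 0) ->
  (size (act_poly f) <= (q ^ d).+1)%N.
Proof.
move=> f0; apply: leq_trans (size_sum _ _ _) _; apply/bigmax_leqP=> i _.
have [le_id|lt_di] := leqP i d; last by rewrite f0 // rmorph0 scale0r size_poly0.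
by apply: leq_trans (size_scale_leq _ _) _; rewrite size_polyXn ltnS leq_exp2l ?card_gt1.
Qed.

(** [q] vanishes in [L], so only the linear term survives; when nonzero, this constant makes the
    polynomial separable. *)
Lemma deriv_act_poly f : (act_poly f)^`() = (emb (skew_coef f 0))%:P.
Proof.
have q0 : q%:R = 0 :> L.
  have pL : pdiv q \in [pchar L].
    apply: pnatPpi (pnat_card_finField (emb \o iota : {rmorphism F -> L})) _.
    by rewrite pi_pdiv card_gt1.
  by apply/eqP; rewrite -(dvdn_pcharf pL) pdiv_dvd.
have drop_i (i : nat) : (emb (skew_coef f i) *: 'X^(q ^ i))^`()
    = if i == 0%N then (emb (skew_coef f 0))%:P else 0.
  case: i => [|i]; rewrite derivZ derivXn /=.
    by rewrite expn0 expr0 mulr1n alg_polyC.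
  by rewrite expnS -scaler_nat natrM q0 mul0r scale0r scaler0.
rewrite raddf_sum /=; under eq_bigr do rewrite drop_i.
case E: (size (f : {poly K})) => [|m].
  by rewrite big_ord0 /skew_coef nth_default ?E // rmorph0.
by rewrite big_ord_recl big1 // addr0.
Qed.

End TwistedAct.

(** * Drinfeld modules acting on L and their torsion *)

Section DrinfeldAct.
Variables (F : finFieldType) (K : fieldType) (iota : {rmorphism F -> K}).
Variables (gamma : {rmorphism {poly F} -> K}) (r : nat).
Variable phi : drinfeld_module iota gamma r.
Variables (L : fieldType) (emb : {rmorphism K -> L}).
Local Notation q := #|F|.
Local Notation inF c := (emb (iota c)).
Local Notation "phi_[ b ]" := (twisted_act emb (phi b)) (format "phi_[ b ]").

Lemma dm_actD b c x : phi_[b + c] x = phi_[b] x + phi_[c] x.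
Proof. by rewrite rmorphD act_addl. Qed.

Lemma dm_actM b c x : phi_[b * c] x = phi_[b] (phi_[c] x).
Proof. by rewrite rmorphM act_mul. Qed.

Lemma dm_actC c x : phi_[c%:P] x = inF c * x.
Proof. by rewrite drinfeldC act_skewC. Qed.

Lemma dm_actZ c b x : phi_[c *: b] x = inF c * phi_[b] x.
Proof. by rewrite -mul_polyC dm_actM dm_actC. Qed.

Lemma dm_act0 x : phi_[0] x = 0.
Proof. by rewrite -[0]polyC0 dm_actC !rmorph0 mul0r. Qed.

Lemma dm_act1 x : phi_[1] x = x.
Proof. by rewrite -[1]polyC1 dm_actC !rmorph1 mul1r. Qed.

Lemma dm_act_sum (I : Type) (s : seq I) (P : pred I) (b : I -> {poly F}) x :
  phi_[\sum_(i <- s | P i) b i] x = \sum_(i <- s | P i) phi_[b i] x.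
Proof.
exact: (big_morph (fun b => phi_[b] x) (fun b c => dm_actD b c x) (dm_act0 x)).
Qed.

Lemma torsionE a x : (x \in torsion phi emb a) = (phi_[a] x == 0).
Proof. by []. Qed.

Lemma torsionP a x : reflect (phi_[a] x = 0) (x \in torsion phi emb a).
Proof. exact: eqP. Qed.

Lemma torsion0 a : 0 \in torsion phi emb a.
Proof. by rewrite torsionE act_0r. Qed.

Lemma torsionD a x y :
  x \in torsion phi emb a -> y \in torsion phi emb a -> x + y \in torsion phi emb a.
Proof. by move=> /torsionP x0 /torsionP y0; apply/torsionP; rewrite act_addr x0 y0 addr0. Qed.

Lemma torsion_act a b x : x \in torsion phi emb a -> phi_[b] x \in torsion phi emb a.
Proof. by move=> /torsionP x0; apply/torsionP; rewrite -dm_actM mulrC dm_actM x0 act_0r. Qed.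

Lemma torsion_dvd a b x : x \in torsion phi emb a -> a %| b -> phi_[b] x = 0.
Proof. by move=> /torsionP x0 /dvdpP[c ->]; rewrite dm_actM x0 act_0r. Qed.

Lemma dm_act_mod a b x : x \in torsion phi emb a -> phi_[b %% a] x = phi_[b] x.
Proof.
move=> Vx; rewrite [in RHS](divp_eq b a) dm_actD.
by rewrite [X in _ = X + _](torsion_dvd Vx) ?dvdp_mull // add0r.
Qed.

Lemma act_poly_phi_neq0 a : a != 0 -> act_poly emb (phi a) != 0.
Proof.
move=> a0; apply: contraNneq (drinfeld_lead phi a0) => p0.
by rewrite -(fmorph_eq0 emb) -coef_act_poly p0 coef0.
Qed.

Lemma size_act_poly_phi a : a != 0 ->
  size (act_poly emb (phi a)) = (q ^ (r * (size a).-1)).+1.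
Proof.
move=> a0; apply/eqP; rewrite eqn_leq size_act_poly; last by move=> i; apply: drinfeld_gt.
apply: contraNltn (drinfeld_lead phi a0) => le_size.
by rewrite -(fmorph_eq0 emb) -coef_act_poly nth_default.
Qed.

End DrinfeldAct.

Lemma exists_nonroot (L : idomainType) (p : {poly L}) (s : seq L) :
  p != 0 -> uniq s -> (size p <= size s)%N -> exists2 z, z \in s & p.[z] != 0.
Proof.
move=> p0 uniq_s le_s; have [/allPn[z zs nz]|/negbNE all_s] := boolP (~~ all (root p) s).
  by exists z.
by have := max_poly_roots p0 all_s uniq_s; rewrite ltnNge le_s.
Qed.

(** The derivative of the additive polynomial is the nonzero constant given by [gamma a], so over
    the closed field [L] there are as many distinct roots as the degree. *)
Lemma torsion_roots (F : finFieldType) (K : fieldType) (iota : {rmorphism F -> K})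
    (gamma : {rmorphism {poly F} -> K}) (r : nat) (phi : drinfeld_module iota gamma r)
    (L : closedFieldType) (emb : {rmorphism K -> L}) (a : {poly F}) :
  gamma a != 0 -> exists s : seq L,
    [/\ uniq s, size s = (#|F| ^ (r * (size a).-1))%N & {subset s <= torsion phi emb a}].
Proof.
move=> ga0; have a0 : a != 0 by apply: contraNneq ga0 => ->; rewrite rmorph0.
set p := act_poly emb (phi a).
have p0 : p != 0 by exact: act_poly_phi_neq0.
have [s pE] := closed_field_poly_normal p.
have lead_p : lead_coef p != 0 by rewrite lead_coef_eq0.
have p_eqp : p %= \prod_(z <- s) ('X - z%:P) by rewrite {1}pE eqp_scale.
exists s; split.
- rewrite -separable_prod_XsubC -(eqp_separable p_eqp).
  rewrite separable_poly.unlock deriv_act_poly drinfeld_coef0 // coprimep_sym.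
  rewrite -[_%:P]alg_polyC coprimepZl ?coprime1p ?fmorph_eq0 //.
- apply: succn_inj; rewrite -(size_prod_XsubC s id) -(eqp_size p_eqp).
  exact: size_act_poly_phi.
move=> z zs; rewrite torsionE -act_polyE -/(root _ z) -/p pE rootZ //.
by rewrite root_prod_XsubC.
Qed.

(** * Multilinearity of determinants and the Moore determinant *)

Lemma det_row_sum (R : comPzRingType) (r N : nat) (A : 'I_r -> 'I_N -> 'I_r -> R) :
  \det (\matrix_(i, j) \sum_k A i k j)
  = \sum_(m : {ffun 'I_r -> 'I_N}) \det (\matrix_(i, j) A i (m i) j).
Proof.
rewrite exchange_big /=; apply: eq_bigr => s _.
rewrite -mulr_sumr; congr (_ * _).
under eq_bigr do rewrite mxE.
rewrite bigA_distr_bigA /=; apply: eq_bigr => m _.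
by apply: eq_bigr => i _; rewrite mxE.
Qed.

Lemma det_scale_rows (R : comPzRingType) (r : nat) (c : 'I_r -> R) (A : 'M[R]_r) :
  \det (\matrix_(i, j) (c i * A i j)) = \prod_i c i * \det A.
Proof.
rewrite /determinant mulr_sumr; apply: eq_bigr => s _.
rewrite mulrCA -big_split; congr (_ * _).
by apply: eq_bigr => i _; rewrite mxE.
Qed.

Lemma fupdE (L : Type) r (beta : {ffun 'I_r.+1 -> L}) (i : 'I_r.+1) (x : L) :
  fupd beta i x = finsert i x [ffun j : 'I_r => beta (lift i j)].
Proof.
apply/ffunP=> j; rewrite !ffunE; case: unliftP => [j'|] -> /=; last by rewrite eqxx.
by rewrite eq_sym (negPf (neq_lift i j')) ffunE.
Qed.

Section Moore.
Variables (F : finFieldType) (K : fieldType) (iota : {rmorphism F -> K}).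
Variables (L : fieldType) (emb : {rmorphism K -> L}).
Local Notation q := #|F|.
Local Notation inF c := (emb (iota c)).

Definition moore_mx s (x : {ffun 'I_s -> L}) : 'M[L]_s :=
  \matrix_(i < s, j < s) x i ^+ (q ^ j).

Definition moore s (x : {ffun 'I_s -> L}) : L := \det (moore_mx x).

(** Cofactors along row [i] ignore that row; the entry 0 serves as a normal form. *)
Lemma moore_cofactor_finsert s (i : 'I_s.+1) (y : L) (t : {ffun 'I_s -> L}) j :
  cofactor (moore_mx (finsert i y t)) i j = cofactor (moore_mx (finsert i 0 t)) i j.
Proof.
congr (_ * \det _); apply/matrixP=> u v.
by rewrite !mxE !finsert_lift.
Qed.

Lemma moore_finsert s (i : 'I_s.+1) (y : L) (t : {ffun 'I_s -> L}) :
  moore (finsert i y t)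
  = \sum_(j < s.+1) y ^+ (q ^ j) * cofactor (moore_mx (finsert i 0 t)) i j.
Proof.
rewrite /moore (expand_det_row _ i); apply: eq_bigr => j _.
by rewrite moore_cofactor_finsert mxE finsert_at.
Qed.

Lemma moore_eq_rows s (x : {ffun 'I_s -> L}) l h : l != h -> x l = x h -> moore x = 0.
Proof.
by move=> lh xlh; apply: (determinant_alternate lh) => j; rewrite !mxE xlh.
Qed.

Lemma moore_tperm s (x : {ffun 'I_s -> L}) l h : l != h ->
  moore [ffun j => x (tperm l h j)] = - moore x.
Proof.
move=> lh; rewrite /moore.
have -> : moore_mx [ffun j => x (tperm l h j)]
    = row_perm (tperm l h) (moore_mx x).
  by apply/matrixP=> i j; rewrite !mxE ffunE.
by rewrite row_permE det_mulmx det_perm odd_tperm lh mulN1r.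
Qed.

Lemma moore_rmorph s (sigma : {rmorphism L -> L}) (x : {ffun 'I_s -> L}) :
  sigma (moore x) = moore [ffun j => sigma (x j)].
Proof.
rewrite /moore -det_map_mx; congr (\det _); apply/matrixP=> i j.
by rewrite !mxE rmorphXn ffunE.
Qed.

(** Stated for arbitrary [g] because the slot argument is applied both to the Moore determinant and
    to the single terms [cofactor_fun] of its expansion. *)
Definition slot_linear s (i : 'I_s.+1) (g : {ffun 'I_s.+1 -> L} -> L) : Prop :=
  (forall y z t, g (finsert i (y + z) t) = g (finsert i y t) + g (finsert i z t))
  /\ (forall c y t, g (finsert i (inF c * y) t) = inF c * g (finsert i y t)).

Lemma slot_linear0 s (i : 'I_s.+1) g t : slot_linear i g -> g (finsert i 0 t) = 0.
Proof. by case=> _ gZ; have := gZ 0 0 t; rewrite !rmorph0 !mul0r. Qed.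

Lemma slot_linear_sum s (i : 'I_s.+1) g n (c : 'I_n -> F) (y : 'I_n -> L) t :
  slot_linear i g ->
  g (finsert i (\sum_k inF (c k) * y k) t) = \sum_k inF (c k) * g (finsert i (y k) t).
Proof.
move=> gL; have [gD gZ] := gL.
rewrite (big_morph (fun z => g (finsert i z t)) (fun y z => gD y z t) (slot_linear0 t gL)).
by apply: eq_bigr => k _; rewrite gZ.
Qed.

Lemma moore_slot_linear s (i : 'I_s.+1) : slot_linear i (@moore s.+1).
Proof.
split=> [y z t | c y t]; rewrite !moore_finsert ?mulr_sumr -?big_split.
  by apply: eq_bigr => j _; rewrite (exprq_D iota emb) mulrDl.
by apply: eq_bigr => j _; rewrite exprMn exprq_F mulrA.
Qed.

(** A term of the Laplace expansion along the first column with its entry modified by [f]; only slot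
    [i] sees [f]. *)
Definition cofactor_fun s (f : L -> L) (i : 'I_s.+1) (x : {ffun 'I_s.+1 -> L}) : L :=
  f (x i) * cofactor (moore_mx x) i ord0.

Lemma cofactor_fun_finsert s f (i : 'I_s.+1) y t :
  cofactor_fun f i (finsert i y t) = f y * cofactor (moore_mx (finsert i 0 t)) i ord0.
Proof. by rewrite /cofactor_fun moore_cofactor_finsert finsert_at. Qed.

Lemma cofactor_fun_slot_linear s (f : L -> L) (i : 'I_s.+1) :
  {morph f : x y / x + y} -> (forall c x, f (inF c * x) = inF c * f x) ->
  slot_linear i (cofactor_fun f i).
Proof.
move=> fD fZ; split=> [y z t|c y t]; rewrite !cofactor_fun_finsert.
  by rewrite fD mulrDl.
by rewrite fZ mulrA.
Qed.

Lemma moore_cofactor_fun s (x : {ffun 'I_s.+1 -> L}) :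
  moore x = \sum_i cofactor_fun id i x.
Proof.
rewrite /moore (expand_det_col _ ord0); apply: eq_bigr => i _.
by rewrite /cofactor_fun mxE expn0 expr1.
Qed.

(** This expands the matrix whose first column is replaced by column [k]; two columns agree unless
    [k] is the first. *)
Lemma moore_alien_cofactor s (x : {ffun 'I_s.+1 -> L}) (k : 'I_s.+1) :
  \sum_i x i ^+ (q ^ k) * cofactor (moore_mx x) i ord0 = moore x *+ (k == ord0).
Proof.
have := congr1 (fun A : 'M_s.+1 => A ord0 k) (mul_adj_mx (moore_mx x)).
rewrite !mxE [ord0 == k]eq_sym => <-; apply: eq_bigr => i _.
by rewrite !mxE mulrC.
Qed.

(** Here the first column is replaced by the q^(s+1)-th powers. Carrying it past the [s] other
    columns yields the Frobenius image of the Moore matrix and the sign that occurs in psi_T. *)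
Lemma moore_top_cofactor s (x : {ffun 'I_s.+1 -> L}) :
  \sum_i x i ^+ (q ^ s.+1) * cofactor (moore_mx x) i ord0 = (-1) ^+ s * moore x ^+ q.
Proof.
pose frob : {rmorphism L -> L} := frobq (emb \o iota : {rmorphism F -> L}).
rewrite -[_ ^+ q]/(frob _) moore_rmorph /moore (expand_det_col _ ord_max) mulr_sumr.
apply: eq_bigr => i _; rewrite mxE ffunE -[frob _]/(_ ^+ q) -exprM -expnS.
rewrite [RHS]mulrCA; congr (_ * _); rewrite /cofactor addn0 mulrA -exprD.
rewrite -[(-1) ^+ (s + _)]signr_odd !oddD addbCA addbb addbF signr_odd.
congr (_ * \det _); apply/matrixP=> u v; rewrite !mxE ffunE.
rewrite -[frob _]/(_ ^+ q) -exprM -expnS; congr (_ ^+ (q ^ _)).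
by rewrite lift0 lift_max.
Qed.

End Moore.

(** * Wedge sums on torsion points *)

Section WedgeSum.
Variables (F : finFieldType) (K : fieldType) (iota : {rmorphism F -> K}).
Variables (gamma : {rmorphism {poly F} -> K}) (rk : nat).
Variable phi : drinfeld_module iota gamma rk.
Variables (L : fieldType) (emb : {rmorphism K -> L}).
Variables (a : {poly F}) (n : nat).
Hypotheses (a_monic : a \is monic) (size_a : size a = n.+2).
Local Notation q := #|F|.
Local Notation inF c := (emb (iota c)).
Local Notation "phi_[ b ]" := (twisted_act emb (phi b)) (format "phi_[ b ]").
Local Notation V := (torsion phi emb a).
Local Notation e k := (drop_poly k.+1 a).

(* With g the Moore determinant and c = 1 this is W_a, see [WmapE]; the number s
   of slots is independent of the rank so that slots can be removed one by one. *)
Definition wedge_sum s (g : {ffun 'I_s -> L} -> L) (c : {poly F})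
    (beta : {ffun 'I_s -> L}) : L :=
  \sum_(k : {ffun 'I_s -> 'I_n.+1}) inF (top_coef_mod a (c * 'X^(\sum_j k j)))
    * g [ffun j => phi_[e (k j)] (beta j)].

Lemma phi_finsert s (i : 'I_s.+1) (k : {ffun 'I_s.+1 -> 'I_n.+1}) y (t : {ffun 'I_s -> L}) :
  [ffun j => phi_[e (k j)] (finsert i y t j)]
  = finsert i (phi_[e (k i)] y) [ffun j : 'I_s => phi_[e (k (lift i j))] (t j)].
Proof.
apply/ffunP=> j; rewrite ffunE; case: (unliftP i j) => [j'|] ->.
  by rewrite !finsert_lift ffunE.
by rewrite !finsert_at.
Qed.

(* Summing over one index by [top_coef_mod_dual]. *)
Lemma wedge_sum_slot s (i : 'I_s.+1) g c y (t : {ffun 'I_s -> L}) :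
  slot_linear iota emb i g -> y \in V ->
  wedge_sum g c (finsert i y t) = \sum_(k : {ffun 'I_s -> 'I_n.+1})
    g (finsert i (phi_[c * 'X^(\sum_j k j)] y) [ffun j => phi_[e (k j)] (t j)]).
Proof.
move=> gL Vy; rewrite /wedge_sum (big_finsert i) exchange_big /=.
apply: eq_bigr => k _; set tk := [ffun j => _].
transitivity (\sum_(x < n.+1) inF (top_coef_mod a (c * 'X^(\sum_j k j) * 'X^x))
    * g (finsert i (phi_[e x] y) tk)).
  apply: eq_bigr => x _; rewrite sum_finsert addnC exprD mulrA phi_finsert finsert_at.
  congr (_ * g (finsert i _ _)); apply/ffunP=> j.
  by rewrite [LHS]ffunE [RHS]ffunE finsert_lift.
rewrite -slot_linear_sum //; congr (g (finsert i _ tk)).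
rewrite -(dm_act_mod _ Vy) -(top_coef_mod_dual a_monic size_a) dm_act_sum.
by apply: eq_bigr => x _; rewrite dm_actZ.
Qed.

(** An operator on a torsion slot is traded for a factor of the weight [c], which belongs to no
    slot; hence operators move between slots. *)
Lemma wedge_sum_act_slot s (i : 'I_s.+1) g b c y (t : {ffun 'I_s -> L}) :
  slot_linear iota emb i g -> y \in V ->
  wedge_sum g c (finsert i (phi_[b] y) t) = wedge_sum g (c * b) (finsert i y t).
Proof.
move=> gL Vy; rewrite !wedge_sum_slot //; last exact: torsion_act.
by apply: eq_bigr => k _; rewrite -dm_actM mulrAC.
Qed.

Lemma wedge_sum_slot_linear s (i : 'I_s.+1) g c :
  slot_linear iota emb i g -> slot_linear iota emb i (wedge_sum g c).
Proof.
case=> gD gZ; split=> [y z t|d y t].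
  rewrite /wedge_sum -big_split; apply: eq_bigr => k _.
  by rewrite !phi_finsert act_addr gD mulrDr.
rewrite /wedge_sum mulr_sumr; apply: eq_bigr => k _.
by rewrite !phi_finsert act_F gZ mulrCA.
Qed.

Local Notation W s := (@wedge_sum s (@moore F L s) 1).

(** By duality the sum over the single index is phi_1, and the Moore determinant of one entry is
    that entry. *)
Lemma wedge1E (beta : {ffun 'I_1 -> L}) : beta ord0 \in V -> W 1 beta = beta ord0.
Proof.
move=> Vb; rewrite -[beta](finsertK ord0) wedge_sum_slot //.
  rewrite (bigD1 [ffun=> ord0]) //= [X in _ + X]big1 ?addr0 => [|k /eqP[]]; last first.
    by apply/ffunP=> -[].
  rewrite big_ord0 expr0 mulr1 dm_act1 !finsert_at.
  rewrite /moore (expand_det_row _ ord0) big_ord1 mxE finsert_at expn0 expr1.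
  by rewrite /cofactor det_mx00 addn0 expr0 !mulr1.
exact: moore_slot_linear.
Qed.

Lemma wedge_tperm s (beta : {ffun 'I_s -> L}) l h : l != h ->
  W s [ffun j => beta (tperm l h j)] = - W s beta.
Proof.
move=> lh; rewrite /wedge_sum -sumrN.
pose T (k : {ffun 'I_s -> 'I_n.+1}) := [ffun j => k (tperm l h j)] : {ffun 'I_s -> 'I_n.+1}.
have TK : involutive T by move=> k; apply/ffunP=> j; rewrite !ffunE tpermK.
rewrite (reindex_inj (inv_inj TK)); apply: eq_bigr => k _.
have -> : (\sum_j T k j = \sum_j k j)%N.
  rewrite [RHS](reindex_inj (@perm_inj _ (tperm l h))) /=.
  by apply: eq_bigr => j _; rewrite ffunE.
rewrite -mulrN -(moore_tperm F _ lh); congr (_ * @moore F L s _).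
by apply/ffunP=> j; rewrite !ffunE.
Qed.

(** Antisymmetry would not suffice in characteristic 2. Terms with k_l = k_h have two equal rows;
    the others cancel in pairs when k_l and k_h are exchanged. *)
Lemma wedge_alternating s (beta : {ffun 'I_s -> L}) l h : l != h ->
  beta l = beta h -> W s beta = 0.
Proof.
move=> lh blh; rewrite /wedge_sum.
pose T (k : {ffun 'I_s -> 'I_n.+1}) := [ffun j => k (tperm l h j)] : {ffun 'I_s -> 'I_n.+1}.
have TK : involutive T by move=> k; apply/ffunP=> j; rewrite !ffunE tpermK.
rewrite (bigID (fun k : {ffun 'I_s -> 'I_n.+1} => (k l < k h)%N)) /=.
rewrite [X in _ + X](bigID (fun k : {ffun 'I_s -> 'I_n.+1} => (k h < k l)%N)) /=.
rewrite [X in _ + (_ + X)]big1 ?addr0; last first.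
  move=> k; rewrite -!leqNgt -eqn_leq => /eqP/val_inj klh.
  by rewrite (moore_eq_rows F lh) ?mulr0 // !ffunE klh blh.
apply/eqP; rewrite addrC addr_eq0; apply/eqP.
rewrite (reindex_inj (inv_inj TK)) -sumrN; apply: eq_big => [k|k _].
  by rewrite !ffunE tpermL tpermR; case: ltngtP.
have -> : (\sum_j T k j = \sum_j k j)%N.
  rewrite [RHS](reindex_inj (@perm_inj _ (tperm l h))) /=.
  by apply: eq_bigr => j _; rewrite ffunE.
rewrite -mulrN -(moore_tperm F _ lh); congr (_ * @moore F L s _).
apply/ffunP=> j; rewrite !ffunE; congr (phi_[_] _).
by case: tpermP => // ->.
Qed.

Lemma wedge_rmorph s (sigma : {rmorphism L -> L}) (beta : {ffun 'I_s -> L}) :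
  (forall c, sigma (emb c) = emb c) ->
  sigma (W s beta) = W s [ffun j => sigma (beta j)].
Proof.
move=> sigmaK; rewrite rmorph_sum; apply: eq_bigr => k _.
rewrite rmorphM /= sigmaK moore_rmorph; congr (_ * @moore F L s _); apply/ffunP=> j.
rewrite !ffunE /twisted_act rmorph_sum; apply: eq_bigr => i _.
by rewrite rmorphM rmorphXn /= sigmaK.
Qed.

End WedgeSum.

(** * Identification of W_a with a wedge sum, and nondegeneracy *)

Section WeilPairing.
Variables (F : finFieldType) (K : fieldType) (iota : {rmorphism F -> K}).
Variables (gamma : {rmorphism {poly F} -> K}) (r : nat).
Variable phi : drinfeld_module iota gamma r.
Variables (L : closedFieldType) (emb : {rmorphism K -> L}).
Variables (a : {poly F}) (n : nat).
Hypotheses (a_monic : a \is monic) (size_a : size a = n.+2).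
Local Notation q := #|F|.
Local Notation inF c := (emb (iota c)).
Local Notation "phi_[ b ]" := (twisted_act emb (phi b)) (format "phi_[ b ]").
Local Notation V := (torsion phi emb a).
Local Notation e k := (drop_poly k.+1 a).
Local Notation W s := (@wedge_sum F K iota gamma r phi L emb a n s (@moore F L s) 1).

Lemma Wmap_cast N (beta : {ffun 'I_r -> L}) : (size a).-1 = N ->
  Wmap phi emb a beta = \sum_(m : {ffun 'I_r -> 'I_N})
    (fpoly r (map_poly (emb \o iota) a))@_[multinom (m j : nat) | j < r] *
    moore_det #|F| (fun j : 'I_r => twisted_act emb (phi 'X^(m j)) (beta j)).
Proof. by move=> <-. Qed.

(** The coefficients of e_k lie in [F], so Frobenius fixes them and they can scale a whole row;
    multilinearity then resums the phi_(T^m) (beta_i) to phi_(e_k) (beta_i). *)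
Lemma WmapE (beta : {ffun 'I_r -> L}) : Wmap phi emb a beta = W r beta.
Proof.
rewrite (@Wmap_cast n.+1) ?size_a //.
pose f : {rmorphism F -> L} := emb \o iota.
under eq_bigr => m _.
  rewrite (mcoeff_fpoly f _ a_monic size_a) rmorph_sum mulr_suml.
  over.
rewrite exchange_big; apply: eq_bigr => k _ /=; rewrite mul1r.
transitivity (f (top_coef_mod a 'X^(\sum_j k j)) * \sum_(m : {ffun 'I_r -> 'I_n.+1})
    \det (\matrix_(i, j < r) ((f (e (k i))`_(m i) * phi_['X^(m i)] (beta i)) ^+ (q ^ j)))).
  rewrite mulr_sumr; apply: eq_bigr => m _.
  rewrite -[emb (iota _)]/(f _) rmorphM -mulrA; congr (_ * _).
  rewrite rmorph_prod -det_scale_rows; congr (\det _); apply/matrixP=> i j.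
  by rewrite !mxE exprMn /= exprq_F.
congr (_ * _); rewrite -(det_row_sum (fun i m j =>
  (f (e (k i))`_m * phi_['X^m] (beta i)) ^+ (q ^ j))).
congr (\det _); apply/matrixP=> i j; rewrite !mxE ffunE -(exprq_sum iota emb); congr (_ ^+ _).
rewrite -[X in phi_[X]]coefK poly_def dm_act_sum.
rewrite (big_ord_widen n.+1 (fun x => phi_[(e (k i))`_x *: 'X^x] (beta i))); last first.
  by rewrite size_drop_poly size_a subSS leq_subr.
rewrite [RHS]big_mkcond; apply: eq_bigr => x _; rewrite dm_actZ; case: ltnP => // le_x.
by rewrite [X in f X]nth_default // rmorph0 mul0r.
Qed.

Lemma skew_coef_tauX j (f : twisted_poly iota) i :
  skew_coef (tau _ ^+ j * f) i = if (j <= i)%N then skew_coef f (i - j) ^+ (q ^ j) else 0.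
Proof.
elim: j i => [|j IHj] i; first by rewrite expr0 mul1r subn0 expn0 expr1.
have tauE (g : twisted_poly iota) k :
    skew_coef (tau _ * g) k = if k is k'.+1 then skew_coef g k' ^+ q else 0.
  rewrite /skew_coef (coef_skew_mul (frobq iota) 'X g k).
  case: k => [|k]; first by rewrite big_ord1 coefX mul0r.
  rewrite !big_ord_recl big1 => [|x _]; last by rewrite coefX mul0r.
  by rewrite !coefX mul0r add0r addr0 mul1r /= subSS subn0.
rewrite exprS -mulrA tauE; case: i => [|i] //; rewrite IHj ltnS subSS.
case: ifP => _; first by rewrite -exprM expnSr.
by rewrite expr0n gtn_eqF // ltnW // card_gt1.
Qed.

Lemma act_tauX j f x : twisted_act emb (tau (frobq iota) ^+ j * f) x
  = twisted_act emb f x ^+ (q ^ j).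
Proof.
rewrite act_mul; set y := twisted_act emb f x.
elim: j => [|j IHj].
  by rewrite [LHS](act_skewC iota emb (1 : K) y) rmorph1 mul1r expr1.
by rewrite exprS act_mul act_tau IHj -exprM expnSr.
Qed.

Section Nondegenerate.
Hypothesis gamma_a : gamma a != 0.

Lemma horner_basis_skew_coef (x : 'I_n.+1) i : (r * n < i)%N -> skew_coef (phi (e x)) i = 0.
Proof.
move=> lt_i; apply: drinfeld_gt.
  by rewrite -size_poly_gt0 size_drop_poly size_a subn_gt0 ltnS.
rewrite size_drop_poly size_a subSS (leq_ltn_trans _ lt_i) // leq_mul2l.
by rewrite subSn 1?leq_ord //= leq_subr orbT.
Qed.

Lemma wedge_last_slot s (beta : {ffun 'I_s.+1 -> L}) : (s.+1 < r)%N ->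
  W s.+1 beta != 0 -> exists2 z, z \in V & W s.+2 (finsert ord_max z beta) != 0.
Proof.
move=> lt_s_r W0.
pose cof (t : {ffun 'I_s.+1 -> 'I_n.+1}) j := cofactor (moore_mx F
  (finsert ord_max 0 [ffun j => phi_[e (t j)] (beta j)])) ord_max j.
pose c x (t : {ffun 'I_s.+1 -> 'I_n.+1}) j := inF (top_coef_mod a 'X^(x + \sum_j t j)) * cof t j.
pose f (x : 'I_n.+1) (j : 'I_s.+2) := tau (frobq iota) ^+ j * phi (e x).
(* [W s.+2] as a polynomial in its last slot, from the expansion of the Moore determinants along the
   last row. *)
pose P : {poly L} := \sum_(x < n.+1) \sum_t \sum_j c x t j *: act_poly emb (f x j).
have PE z : P.[z] = W s.+2 (finsert ord_max z beta).
  rewrite /wedge_sum (big_finsert ord_max) horner_sum; apply: eq_bigr => x _.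
  rewrite horner_sum; apply: eq_bigr => t _.
  rewrite phi_finsert finsert_at moore_finsert mulr_sumr horner_sum; apply: eq_bigr => j _.
  rewrite hornerZ act_polyE act_tauX mul1r sum_finsert mulrAC mulrA.
  rewrite /cof; congr (_ * cofactor (moore_mx F (finsert ord_max 0 _)) _ _).
  by apply/ffunP=> u; rewrite [LHS]ffunE [RHS]ffunE finsert_lift.
(* The highest power of tau: [r * n] from e_0, which has degree [n], and [s.+1] from the last
   column. *)
pose D := (r * n + s.+1)%N.
(* A smaller column or a larger [x] lowers the degree in tau. *)
have f0 x j : ~~ ((x == ord0) && (j == ord_max)) -> skew_coef (f x j) D = 0.
  rewrite skew_coef_tauX; case: ifP => // le_j_D.
  have [->|ne_j] := eqVneq j ord_max; last first.
    rewrite horner_basis_skew_coef ?exprq_0 // /D -addnBA 1?leq_ord //.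
    rewrite -[X in (X < _)%N]addn0 ltn_add2l subn_gt0 ltn_neqAle -ltnS ltn_ord andbT.
    by rewrite -val_eqE in ne_j.
  rewrite andbT -val_eqE /= -lt0n => x_gt0; rewrite /D addnK drinfeld_gt ?exprq_0 //.
    by rewrite -size_poly_gt0 size_drop_poly size_a subn_gt0 ltnS.
  rewrite size_drop_poly size_a subSS ltn_mul2l (leq_trans _ lt_s_r) //=.
  by rewrite subSn 1?leq_ord //= ltn_subrL x_gt0 (leq_trans x_gt0) ?leq_ord.
(* The corner cofactor is the Moore determinant of the other slots, and [x = 0] adds nothing to the
   exponent in the weight, so [W s.+1] reappears. *)
have coefP : P`_(q ^ D) = W s.+1 beta * emb (skew_coef (phi (e 0%N)) (r * n)) ^+ (q ^ s.+1).
  rewrite coef_sum (bigD1 ord0) //= [X in _ + X]big1 ?addr0 => [|x x0]; last first.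
    rewrite coef_sum big1 // => t _; rewrite coef_sum big1 // => j _.
    by rewrite coefZ coef_act_poly f0 ?(negPf x0) // rmorph0 mulr0.
  rewrite coef_sum mulr_suml; apply: eq_bigr => t _.
  rewrite coef_sum (bigD1 ord_max) //= [X in _ + X]big1 ?addr0 => [|j j0]; last first.
    by rewrite coefZ coef_act_poly f0 ?(negPf j0) ?andbF // rmorph0 mulr0.
  rewrite coefZ coef_act_poly skew_coef_tauX leq_addl addnK rmorphXn mul1r.
  congr (_ * _ * _); rewrite /cof /cofactor -signr_odd oddD addbb expr0 mul1r.
  congr (\det _); apply/matrixP=> u v; rewrite !mxE finsert_lift; congr (_ ^+ (q ^ _)).
  by rewrite lift_max.
have P0 : P != 0.
  apply: contraNneq W0 => P0; move/eqP: coefP; rewrite P0 coef0 eq_sym mulf_eq0.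
  rewrite expf_eq0 fmorph_eq0 => /orP[] // /andP[_].
  have := drinfeld_lead phi (_ : e 0%N != 0).
  rewrite -size_poly_gt0 size_drop_poly size_a subn1 /= => /(_ isT).
  by rewrite mulnC => /negPf ->.
have sizeP : (size P <= (q ^ D).+1)%N.
  apply: leq_trans (size_sum _ _ _) _; apply/bigmax_leqP=> x _.
  apply: leq_trans (size_sum _ _ _) _; apply/bigmax_leqP=> t _.
  apply: leq_trans (size_sum _ _ _) _; apply/bigmax_leqP=> j _.
  apply: leq_trans (size_scale_leq _ _) _; apply: size_act_poly => i lt_i.
  rewrite skew_coef_tauX; case: ifP => // le_i.
  rewrite horner_basis_skew_coef ?exprq_0 // ltn_subRL.
  by apply: leq_ltn_trans lt_i; rewrite addnC leq_add2l leq_ord.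
have [S [uniqS sizeS subS]] := torsion_roots phi emb gamma_a.
(* [s.+1 < r] puts the degree below the number [q ^ (r * n.+1)] of torsion points. *)
have [] := exists_nonroot P0 uniqS.
  apply: leq_trans sizeP _; rewrite sizeS ltn_exp2l ?card_gt1 // size_a /=.
  by rewrite /D mulnS [(r + _)%N]addnC ltn_add2l.
by move=> z /subS Vz; rewrite PE => W'; exists z.
Qed.

Lemma wedge_nonzero s x : (s < r)%N -> x \in V -> x != 0 ->
  exists beta : {ffun 'I_s.+1 -> L},
    [/\ forall j, beta j \in V, beta ord0 = x & W s.+1 beta != 0].
Proof.
move=> + Vx x0; elim: s => [|s IHs] lt_s.
  exists [ffun=> x]; split=> [j||]; rewrite ?ffunE //.
  by rewrite (wedge1E a_monic size_a) ffunE.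
have [beta [Vb b0 Wb]] := IHs (ltnW lt_s).
have [z Vz Wz] := wedge_last_slot lt_s Wb.
exists (finsert ord_max z beta); split=> [j||] //.
  by case: (unliftP ord_max j) => [j'|] ->; rewrite ?finsert_lift ?finsert_at.
rewrite -b0 -(finsert_lift ord_max z beta ord0); congr (finsert _ _ _ _).
exact: val_inj.
Qed.

End Nondegenerate.
End WeilPairing.

(** * Irreducible factors and primary parts of polynomials *)

Lemma irreducible_factor (F : finFieldType) (d : {poly F}) : (1 < size d)%N ->
  exists2 p, irreducible_poly p & p %| d.
Proof.
have [m] := ubnP (size d); elim: m d => // m IHm d lt_d d_gt1.
have [/irreducibleP irr_d|] := boolP (irreducibleb d); first by exists d.
rewrite /irreducibleb d_gt1 /= negb_forall => /existsP[c].
rewrite negb_imply -ltnNge -Pdiv.Idomain.dvdpE => /andP[c_d c_gt1].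
have lt_c : (size c < size d)%N.
  rewrite -[X in (_ < X)%N](ltn_predK d_gt1) ltnS.
  exact: size_npoly.
have [|p irr_p p_c] := IHm c _ c_gt1; first by rewrite (leq_trans lt_c).
by exists p => //; apply: dvdp_trans c_d.
Qed.

Lemma irreducible_part (F : fieldType) (p d : {poly F}) : irreducible_poly p -> d != 0 ->
  exists k, exists2 c, d = p ^+ k * c & coprimep p c.
Proof.
move=> irr_p; have [m] := ubnP (size d); elim: m d => // m IHm d lt_d d0.
have [p_d|] := boolP (p %| d); last first.
  by rewrite -irreducible_poly_coprime // => ?; exists 0%N; exists d; rewrite ?mul1r.
have dE := divpK p_d; have d'0 : d %/ p != 0 by rewrite dvdp_div_eq0.
have [|k [c d'E cop]] := IHm (d %/ p) _ d'0.
  rewrite ltnS in lt_d; apply: leq_trans lt_d; have [p_gt1 _] := irr_p.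
  rewrite size_divp ?irredp_neq0 // ltn_subrL size_poly_gt0 d0 andbT.
  by rewrite -subn1 subn_gt0.
by exists k.+1; exists c => //; rewrite -dE d'E exprS mulrC mulrA.
Qed.

(** * Compatibility of W_a with psi, and gluing of values *)

Section Determinant.
Variables (F : finFieldType) (K : fieldType) (iota : {rmorphism F -> K}).
Variables (gamma : {rmorphism {poly F} -> K}) (s : nat).
Variables (phi : drinfeld_module iota gamma s.+1) (psi : drinfeld_module iota gamma 1).
Hypothesis psiT : psi 'X = skewC _ (gamma 'X)
  + skewC _ ((-1) ^+ s * skew_coef (phi 'X) s.+1) * tau _.
Variables (L : closedFieldType) (emb : {rmorphism K -> L}).
Variables (a : {poly F}) (n : nat).
Hypotheses (a_monic : a \is monic) (size_a : size a = n.+2).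
Local Notation q := #|F|.
Local Notation inF c := (emb (iota c)).
Local Notation "phi_[ b ]" := (twisted_act emb (phi b)) (format "phi_[ b ]").
Local Notation "psi_[ b ]" := (twisted_act emb (psi b)) (format "psi_[ b ]").
Local Notation V := (torsion phi emb a).
Local Notation wedge g c := (@wedge_sum F K iota gamma s.+1 phi L emb a n s.+1 g c).
Local Notation W := (wedge (@moore F L s.+1) 1).

Lemma psiX_act x :
  psi_['X] x = emb (gamma 'X) * x + (-1) ^+ s * emb (skew_coef (phi 'X) s.+1) * x ^+ q.
Proof.
by rewrite psiT act_addl act_skewC act_mul act_skewC act_tau rmorphM rmorph_sign.
Qed.

(* The determinant of phi, in the guise: psi_T acts on the Moore determinant by
   letting phi_T act on its first column. *)
Lemma psiX_moore (x : {ffun 'I_s.+1 -> L}) :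
  psi_['X] (moore F x) = \sum_i cofactor_fun F phi_['X] i x.
Proof.
have X0 : 'X != 0 :> {poly F} by rewrite polyX_eq0.
have phiX y : phi_['X] y
    = \sum_(k < s.+2) emb (skew_coef (phi 'X) k) * y ^+ (q ^ k).
  apply: act_wide; apply/leq_sizeP => i lt_i.
  by apply: (drinfeld_gt phi X0); rewrite size_polyX muln1.
rewrite psiX_act /cofactor_fun.
under eq_bigr do rewrite phiX mulr_suml.
(* [k = s.+1] gives the tau term of psi_T and [k = 0] gives gamma(T); the other [k] repeat a column
   and vanish. *)
rewrite exchange_big big_ord_recr /=; congr (_ + _).
  rewrite (bigD1 ord0) //= [X in _ = _ + X]big1 ?addr0 => [|k k0].
    under eq_bigr do rewrite -mulrA.
    rewrite -mulr_sumr (moore_alien_cofactor F x ord0) eqxx mulr1n.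
    by rewrite drinfeld_coef0.
  under eq_bigr do rewrite -mulrA.
  by rewrite -mulr_sumr (moore_alien_cofactor F x k) (negPf k0) mulr0n mulr0.
under eq_bigr do rewrite -mulrA.
by rewrite -mulr_sumr (moore_top_cofactor iota emb) mulrCA mulrA.
Qed.

(** In the [i]-th cofactor term phi_T acts on slot [i] alone, where it is traded for the weight
    ['X]; the terms then add up to the Moore determinant again. *)
Lemma psiX_wedge (beta : {ffun 'I_s.+1 -> L}) : (forall j, beta j \in V) ->
  psi_['X] (W beta) = wedge (@moore F L s.+1) 'X beta.
Proof.
move=> Vb; rewrite act_sumr.
transitivity (\sum_i wedge (cofactor_fun F phi_['X] i) 1 beta).
  rewrite /wedge_sum [RHS]exchange_big; apply: eq_bigr => k _.
  by rewrite act_F psiX_moore mulr_sumr.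
transitivity (\sum_i wedge (cofactor_fun F id i) 'X beta).
  apply: eq_bigr => i _; rewrite -(finsertK i beta) !wedge_sum_slot //.
  - by apply: eq_bigr => k _; rewrite !cofactor_fun_finsert mul1r -dm_actM.
  - exact: cofactor_fun_slot_linear.
  apply: cofactor_fun_slot_linear => [y z|c y]; [exact: act_addr|exact: act_F].
rewrite /wedge_sum [LHS]exchange_big; apply: eq_bigr => k _ /=.
by rewrite -mulr_sumr moore_cofactor_fun.
Qed.

Lemma finsert_torsion (i : 'I_s.+1) x (t : {ffun 'I_s -> L}) j :
  x \in V -> (forall j, t j \in V) -> finsert i x t j \in V.
Proof.
by move=> Vx Vt; case: (unliftP i j) => [j'|] ->; rewrite ?finsert_lift ?finsert_at.
Qed.

(** psi_T on the value and phi_T on slot [i] both multiply the weight by ['X]; Horner's scheme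
    extends this to all [c]. *)
Lemma psi_wedge c (i : 'I_s.+1) x (t : {ffun 'I_s -> L}) : x \in V -> (forall j, t j \in V) ->
  psi_[c] (W (finsert i x t)) = W (finsert i (phi_[c] x) t).
Proof.
move=> + Vt; have WL := wedge_sum_slot_linear phi a n 1 (moore_slot_linear iota emb i).
have [WD WZ] := WL.
elim/poly_ind: c x => [|b c IHb] x Vx.
  by rewrite !dm_act0 (slot_linear0 _ WL).
rewrite !dm_actD WD !dm_actC WZ; congr (_ + _).
rewrite !dm_actM psiX_wedge; last by move=> j; apply: finsert_torsion.
rewrite -IHb; last exact: torsion_act.
by rewrite wedge_sum_act_slot // ?mul1r //; exact: moore_slot_linear.
Qed.

Lemma wedge_torsion (beta : {ffun 'I_s.+1 -> L}) :
  (forall j, beta j \in V) -> W beta \in torsion psi emb a.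
Proof.
move=> Vb; apply/torsionP; rewrite -(finsertK ord0 beta) psi_wedge // => [|j].
  move/torsionP: (Vb ord0) => ->.
  exact: (slot_linear0 _ (wedge_sum_slot_linear phi a n 1 (moore_slot_linear iota emb ord0))).
by rewrite ffunE.
Qed.

Lemma psi_wedge_all c (beta : {ffun 'I_s.+1 -> L}) : (forall j, beta j \in V) ->
  W [ffun j => phi_[c] (beta j)] = psi_[c ^+ s.+1] (W beta).
Proof.
move=> Vb; pose B (m : nat) : {ffun 'I_s.+1 -> L} :=
  [ffun j : 'I_s.+1 => if (j < m)%N then phi_[c] (beta j) else beta j].
have -> : [ffun j => phi_[c] (beta j)] = B s.+1.
  by apply/ffunP=> j; rewrite !ffunE ltn_ord.
have VB m j : B m j \in V by rewrite ffunE; case: ifP => _ //; exact: torsion_act.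
suff: forall m, (m <= s.+1)%N -> W (B m) = psi_[c ^+ m] (W beta) by apply.
elim=> [|m IHm] lt_m.
  by rewrite expr0 dm_act1; congr (W _); apply/ffunP=> j; rewrite ffunE.
rewrite exprS dm_actM -IHm 1?ltnW // -(finsertK (Ordinal lt_m) (B m)) psi_wedge //; last first.
  by move=> j; rewrite ffunE.
congr (W _); rewrite -[LHS](finsertK (Ordinal lt_m)); congr (finsert _ _ _).
  by rewrite !ffunE /= ltnSn ltnn.
apply/ffunP=> j; rewrite !ffunE; congr (if _ then _ else _).
by rewrite ltnS leq_eqVlt (negPf (_ : _ != m)) // eq_sym; exact: neq_lift.
Qed.

(* Gluing along an idempotent ep of A/a. *)
Lemma wedge_glue ep (beta beta' : {ffun 'I_s.+1 -> L}) : a %| ep * (1 - ep) ->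
  (forall j, beta j \in V) -> (forall j, beta' j \in V) ->
  exists2 beta'' : {ffun 'I_s.+1 -> L}, forall j, beta'' j \in V &
    forall b, (a %| b * (1 - ep) -> psi_[b] (W beta'') = psi_[b] (W beta'))
      /\ (a %| b * ep -> psi_[b] (W beta'') = psi_[b] (W beta)).
Proof.
move=> a_ep Vb Vb'.
pose b'' : {ffun 'I_s.+1 -> L} := [ffun j => phi_[ep] (beta' j) + phi_[1 - ep] (beta j)].
have Vb'' j : b'' j \in V by rewrite ffunE torsionD ?torsion_act.
(* [1 - e] divides [1 - e ^+ s.+1], and this power of [e] is what comes out when [e] acts on all
   [s.+1] slots. *)
have psi_pow y b e : y \in torsion psi emb a -> a %| b * (1 - e) ->
    psi_[b] y = psi_[b] (psi_[e ^+ s.+1] y).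
  move=> Vy a_b; rewrite -dm_actM -[b in LHS](subrK (b * e ^+ s.+1)) dm_actD.
  rewrite (torsion_dvd Vy) ?add0r //.
  rewrite -{1}[b]mulr1 -mulrBr -[1 in X in _ * X](expr1n _ s.+1) subrXX mulrA.
  exact: dvdp_mulr.
have glue e (v w : {ffun 'I_s.+1 -> L}) b : (forall j, v j \in V) -> (forall j, w j \in V) ->
    (forall j, phi_[e] (v j) = phi_[e] (w j)) -> a %| b * (1 - e) ->
    psi_[b] (W v) = psi_[b] (W w).
  move=> Vv Vw vw a_b; rewrite !(psi_pow (W _) b e) ?wedge_torsion //.
  rewrite -!psi_wedge_all //; congr (psi_[b] (W _)).
  by apply/ffunP=> j; rewrite !ffunE.
exists b'' => // b; split=> a_b.
  apply: (glue ep) => // j; rewrite ffunE act_addr -!dm_actM (torsion_dvd (Vb j)) // addr0.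
  rewrite -[in RHS](mulr1 ep) -[1 in RHS](subrK ep) mulrDr dm_actD.
  by rewrite (torsion_dvd (Vb' j) a_ep) add0r.
apply: (glue (1 - ep)) => //; last by rewrite opprB addrC subrK.
move=> j; rewrite ffunE act_addr -!dm_actM.
rewrite (torsion_dvd (Vb' j)) ?add0r; last by rewrite mulrC.
have -> : phi_[1 - ep] (beta j) = phi_[(1 - ep) * (1 - ep) + (1 - ep) * ep] (beta j).
  by rewrite -mulrDr subrK mulr1.
rewrite dm_actD.
by rewrite [X in _ = _ + X](torsion_dvd (Vb j)) ?addr0 // mulrC.
Qed.

(** * Generators of psi[a] and surjectivity *)

Section Surjective.
Hypothesis gamma_a : gamma a != 0.

Let a0 : a != 0. Proof. exact: monic_neq0. Qed.

Lemma wedge_nonzero_slot (i : 'I_s.+1) x : x \in V -> x != 0 ->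
  exists beta : {ffun 'I_s.+1 -> L},
    [/\ forall j, beta j \in V, beta i = x & W beta != 0].
Proof.
move=> Vx x0.
have [beta [Vb b0 Wb]] := wedge_nonzero a_monic size_a gamma_a (ltnSn s) Vx x0.
have [->|i0] := eqVneq i ord0; first by exists beta.
exists [ffun j => beta (tperm i ord0 j)]; split=> [j||].
- by rewrite ffunE.
- by rewrite ffunE tpermL.
by rewrite wedge_tperm // oppr_eq0.
Qed.

(** The additive polynomial of [a %/ p] has degree less than the number of points of phi[a], so some
    point has nonzero image under phi_(a/p); nondegeneracy is applied to that image. *)
Lemma wedge_not_killed p : irreducible_poly p -> p %| a ->
  exists2 beta : {ffun 'I_s.+1 -> L}, forall j, beta j \in V & psi_[a %/ p] (W beta) != 0.
Proof.
move=> irr_p p_a; have [p_gt1 _] := irr_p.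
have d0 : a %/ p != 0 by rewrite dvdp_div_eq0.
have [S [uniqS sizeS subS]] := torsion_roots phi emb gamma_a.
have [|x /subS Vx] := exists_nonroot (act_poly_phi_neq0 phi emb d0) uniqS.
  rewrite size_act_poly_phi // sizeS ltn_exp2l ?card_gt1 // ltn_mul2l /=.
  rewrite size_divp ?irredp_neq0 // size_a /=.
  by case: (size p) p_gt1 => [|[|m]] //= _; rewrite subSS ltnS -subn1 leq_subLR add1n leq_subr.
rewrite act_polyE => phix0.
have [beta [Vb b0 Wb]] := wedge_nonzero_slot ord0 (torsion_act (a %/ p) Vx) phix0.
exists (finsert ord0 x [ffun j : 'I_s => beta (lift ord0 j)]).
  by move=> j; apply: finsert_torsion => // j'; rewrite ffunE.
rewrite psi_wedge // => [|j]; last by rewrite ffunE.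
by rewrite -b0 finsertK.
Qed.

(** Induction on the divisor [d] while the operators [a %/ p] stay fixed: a tuple good for [d %/ p]
    is glued with one good for [p]. *)
Lemma wedge_not_killed_all d : d %| a ->
  exists2 beta : {ffun 'I_s.+1 -> L}, forall j, beta j \in V &
    forall p, irreducible_poly p -> p %| d -> psi_[a %/ p] (W beta) != 0.
Proof.
have [m] := ubnP (size d); elim: m d => // m IHm d lt_d d_a.
have d0 : d != 0 by apply: contraTneq d_a => ->; rewrite dvd0p.
have [le_d1|d_gt1] := leqP (size d) 1.
  exists [ffun=> 0] => [j|p [p_gt1 _] p_d]; first by rewrite ffunE torsion0.
  by have := leq_trans (dvdp_leq d0 p_d) le_d1; rewrite leqNgt p_gt1.
have [p irr_p p_d] := irreducible_factor d_gt1; have [p_gt1 _] := irr_p.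
have p_a := dvdp_trans p_d d_a.
have dE := divpK p_d.
have [||beta Vb Wb] := IHm (d %/ p).
- rewrite ltnS in lt_d; apply: leq_trans lt_d.
  rewrite size_divp ?irredp_neq0 // ltn_subrL size_poly_gt0 d0 andbT.
  by rewrite -subn1 subn_gt0.
- by apply: dvdp_trans d_a; rewrite -{2}dE dvdp_mulr.
have [beta' Vb' Wb'] := wedge_not_killed irr_p p_a.
have [k [c aE cop_c]] := irreducible_part irr_p a0.
have k_gt0 : (0 < k)%N.
  case: k aE => // aE; move: p_a; rewrite aE mul1r => p_c.
  by move: cop_c; rewrite irreducible_poly_coprime // p_c.
have /Bezout_eq1_coprimepP[[u v] /= uv1] : coprimep (p ^+ k) c by rewrite coprimep_expl.
(* [v * c] is 1 modulo [p ^+ k] and 0 modulo [c]: the idempotent of the p-primary part. *)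
have epE : 1 - v * c = u * p ^+ k by rewrite -uv1 addrK.
have [|b'' Vb'' Wb''] := wedge_glue (ep := v * c) _ Vb Vb'.
  by rewrite epE {1}aE mulrACA [v * u * _]mulrC [c * _]mulrC dvdp_mulr.
exists b'' => // p' irr_p' p'_d; have p'_a := dvdp_trans p'_d d_a.
have [W1 W2] := Wb'' (a %/ p').
(* If [p'] is associated to [p], the glued value behaves like that of [beta']; otherwise [p']
   divides both [c] and [d %/ p], and [beta] decides. *)
have [p'_pk|] := boolP (p' %| p ^+ k).
  have p'_p : p' %| p.
    apply: contraTT p'_pk; rewrite -!irreducible_poly_coprime //.
    by rewrite coprimep_pexpr.
  have eq_p : p' %= p by case: irr_p => _; apply=> //; case: irr_p' => /gtn_eqF ->.
  rewrite W1; last first.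
    by rewrite epE -{1}(divpK p'_a) dvdp_mul // dvdp_mull.
  apply: contraNneq Wb' => W0.
  have /dvdpP[w ->] : a %/ p' %| a %/ p by rewrite (eqp_dvdl _ (eqp_divr a eq_p)).
  by rewrite dm_actM W0 act_0r.
rewrite -irreducible_poly_coprime // => cop_p'.
rewrite W2; last first.
  rewrite -{1}(divpK p'_a) dvdp_mul // dvdp_mull //.
  by move: p'_a; rewrite aE Gauss_dvdpr.
apply: Wb => //; rewrite -(Gauss_dvdpl (d %/ p) (q := p)) ?dE //.
by rewrite -(coprimep_pexpr _ _ k_gt0).
Qed.

(** If psi_b kills [y], so does psi_g for [g = gcdp a b]. For nonzero [b] of degree less than deg a,
    an irreducible [p] divides [a %/ g], and then [a %/ p] is a multiple of [g], against the
    assumption. So the polynomials of degree less than deg a give distinct values, as many as psi_a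
    can have roots. *)
Lemma psi_generator y : y \in torsion psi emb a ->
  (forall p, irreducible_poly p -> p %| a -> psi_[a %/ p] y != 0) ->
  forall z, z \in torsion psi emb a -> exists b, psi_[b] y = z.
Proof.
move=> Vy gen z Vz.
have inj b : psi_[b] y = 0 -> (size b <= n.+1)%N -> b = 0.
  move=> by0 le_b; apply/eqP; apply: contraT => b0.
  have [[u v] /= uvE] := Bezoutp a b.
  have g_a := dvdp_gcdl a b; have g_b := dvdp_gcdr a b.
  have gy : psi_[gcdp a b] y = 0.
    have /dvdpP[w ->] : u * a + v * b %| gcdp a b by rewrite (eqp_dvdl _ uvE).
    rewrite dm_actM dm_actD !dm_actM by0; move/torsionP: Vy => ->.
    by rewrite !act_0r addr0 act_0r.
  have [|p irr_p p_d] := irreducible_factor (d := a %/ gcdp a b).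
    rewrite size_divp ?gcdp_eq0 ?(negPf a0) // size_a.
    have := leq_trans (dvdp_leq b0 g_b) le_b.
    have : (0 < size (gcdp a b))%N by rewrite size_poly_gt0 gcdp_eq0 (negPf a0).
    by case: (size (gcdp a b)) => //= w _ lt_w; rewrite ltn_subRL addn1 ltnS.
  have aE := divpK g_a.
  have p_a : p %| a by rewrite -aE dvdp_mulr.
  case/eqP: (gen p irr_p p_a).
  have -> : a %/ p = a %/ gcdp a b %/ p * gcdp a b.
    by apply/eqP; rewrite eq_sym dvdp_eq_div ?irredp_neq0 // mulrAC divpK // aE.
  by rewrite dm_actM gy act_0r.
pose img := [seq psi_[val b] y | b : {poly_n.+1 F} <- enum {poly_n.+1 F}].
have uniq_img : uniq img.
  rewrite map_inj_uniq ?enum_uniq // => b c eq_bc; apply: val_inj; apply/eqP.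
  rewrite -subr_eq0; apply/eqP; apply: inj.
    rewrite dm_actD eq_bc -mulN1r -polyCN dm_actM dm_actC !rmorphN !rmorph1 mulN1r.
    by rewrite subrr.
  by rewrite (leq_trans (size_polyD _ _)) // geq_max size_polyN !size_npoly.
have [/mapP[b _ ->]|z_img] := boolP (z \in img); first by exists (val b).
have roots_img : all (root (act_poly emb (psi a))) (z :: img).
  rewrite /= /root act_polyE -torsionE Vz /=; apply/allP=> w /mapP[b _ ->].
  by rewrite /root act_polyE -torsionE torsion_act.
(* A point [z] outside the image would be one root too many. *)
have := max_poly_roots (act_poly_phi_neq0 psi emb a0) roots_img.
rewrite size_act_poly_phi // size_a mul1n /= z_img uniq_img size_map -cardE card_npoly.
by rewrite ltnn => /(_ isT).
Qed.

(** Any psi_b can be moved into slot 0, so the values are stable under psi and one generator among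
    them is enough. *)
Lemma wedge_surjective z : z \in torsion psi emb a ->
  exists2 beta : {ffun 'I_s.+1 -> L}, forall j, beta j \in V & W beta = z.
Proof.
move=> Vz; have [beta Vb Wb] := wedge_not_killed_all (dvdpp a).
have [b <-] := psi_generator (wedge_torsion Vb) Wb Vz.
exists (finsert ord0 (phi_[b] (beta ord0)) [ffun j : 'I_s => beta (lift ord0 j)]).
  by move=> j; apply: finsert_torsion => [|j']; rewrite ?ffunE ?torsion_act.
by rewrite -psi_wedge ?finsertK // => j; rewrite ffunE.
Qed.

End Surjective.
End Determinant.

Theorem theorem4p3
  (F : finFieldType) (K : fieldType) (iota : {rmorphism F -> K})
  (gamma : {rmorphism {poly F} -> K})
  (gammaC : forall c : F, gamma c%:P = iota c)
  (Kbar : closedFieldType) (emb : {rmorphism K -> Kbar})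
  (Kbar_alg : forall x : Kbar, algebraicOver emb x)
  (r : nat) (r_gt0 : (0 < r)%N)
  (phi : drinfeld_module iota gamma r)
  (psi : drinfeld_module iota gamma 1)
  (psiT : psi 'X = skewC _ (gamma 'X)
                   + skewC _ ((-1) ^+ r.-1 * skew_coef (phi 'X) r) * tau _)
  (a : {poly F}) (a_monic : a \is monic) (a_deg : (1 <= (size a).-1)%N) :
  let W := Wmap phi emb a in
  let phi_a := torsion phi emb a in
  let psi_a := torsion psi emb a in
  let in_phi_a (beta : {ffun 'I_r -> Kbar}) := forall j, beta j \in phi_a in
  (forall beta, in_phi_a beta -> W beta \in psi_a)
  /\ (forall (i : 'I_r) (beta : {ffun 'I_r -> Kbar}), in_phi_a beta ->
       (forall x y, x \in phi_a -> y \in phi_a ->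
          W (fupd beta i (x + y)) = W (fupd beta i x) + W (fupd beta i y))
       /\ (forall (b : {poly F}) x, x \in phi_a ->
          W (fupd beta i (twisted_act emb (phi b) x))
          = twisted_act emb (psi b) (W (fupd beta i x))))
  /\ (forall beta, in_phi_a beta ->
       forall l h : 'I_r, l != h -> beta l = beta h -> W beta = 0)
  /\ (gamma a != 0 ->
       (forall y, y \in psi_a -> exists2 beta, in_phi_a beta & W beta = y)
       /\ (forall (i : 'I_r) x, x \in phi_a ->
            (forall beta, in_phi_a beta -> beta i = x -> W beta = 0) -> x = 0))
  /\ (forall sigma : {rmorphism Kbar -> Kbar}, bijective sigma ->
       (forall c : K, sigma (emb c) = emb c) ->
       forall beta, in_phi_a beta ->
         sigma (W beta) = W [ffun j => sigma (beta j)]).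
Proof.
case: r r_gt0 phi psiT => // s _ {}phi {}psiT W phi_a psi_a in_phi_a.
(* With [r = s.+1] the sign in psi_T is [(-1) ^+ s]; the degree of [a] is [n.+1]. *)
pose n := (size a).-2.
have size_a : size a = n.+2 by rewrite /n; case: (size a) a_deg => [|[]].
pose W' := wedge_sum phi emb a n (@moore F Kbar s.+1) 1.
have WE beta : W beta = W' beta by exact: (WmapE phi emb a_monic size_a).
have slot (beta : {ffun 'I_s.+1 -> Kbar}) (i : 'I_s.+1) : in_phi_a beta ->
    forall j : 'I_s, [ffun j : 'I_s => beta (lift i j)] j \in phi_a.
  by move=> Vb j; rewrite ffunE.
split; [|split; [|split; [|split]]].
- by move=> beta Vb; rewrite WE; apply: wedge_torsion.
- move=> i beta Vb; split=> [x y _ _|b x Vx]; rewrite !WE !fupdE.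
    by case: (wedge_sum_slot_linear phi a n 1 (moore_slot_linear iota emb i)).
  by rewrite /W' -(psi_wedge psiT a_monic size_a) //; apply: slot.
- by move=> beta Vb l h lh blh; rewrite WE; apply: wedge_alternating lh blh.
- move=> ga; split=> [z Vz|i x Vx W0].
    have [beta Vb <-] := wedge_surjective psiT a_monic size_a ga Vz.
    by exists beta.
  apply/eqP; apply: contraT => x0.
  have [beta [Vb bi]] := wedge_nonzero_slot a_monic size_a ga i Vx x0.
  by rewrite -/W' -WE W0 ?eqxx.
move=> sigma _ sigmaK beta _; rewrite !WE; exact: wedge_rmorph.
Qed.
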